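(* Let $\mathcal{H}$ be a separable Hilbert space, let $\mathfrak{S}_0$ be a convex subset of the set $\mathfrak{S}(\mathcal{H})$ of quantum states, and let $\widetilde{\mathfrak{S}}_0=\{c\varrho : \varrho\in\mathfrak{S}_0,\ c\ge 0\}$ be the cone generated by it. Let $a_f,b_f$ be continuous functions on $[0,1]$ with $a_f(0)=b_f(0)=0$, $a_f(p)=a_f(1-p)$ and $b_f(p)=b_f(1-p)$ for all $p\in[0,1]$, both concave and non-decreasing on $[0,\frac12]$. Let $f:\mathfrak{S}_0\to[0,+\infty]$ be a function such that $$f(p\varrho+(1-p)\varsigma)\ge pf(\varrho)+(1-p)f(\varsigma)-a_f(p),\qquad f(p\varrho+(1-p)\varsigma)\le pf(\varrho)+(1-p)f(\varsigma)+b_f(p)$$ for all $\varrho,\varsigma\in\mathfrak{S}_0$ and $p\in[0,1]$ (with possible values $+\infty$ on both sides). Let $\tilde f$ be the homogeneous extension of $f$ to $\widetilde{\mathfrak{S}}_0$. Let $\rho\in\mathfrak{S}_0$ be a state such that (a) $h(\rho)\in\widetilde{\mathfrak{S}}_0$ for any function $h:\mathbb{R}_+\to\mathbb{R}_+$ with $h(x)\le x$ for all $x\in\mathbb{R}_+$; (b) $[\rho-\sigma]_\pm\in\widetilde{\mathfrak{S}}_0$ for any state $\sigma\in\mathfrak{S}_0$ such that $[\rho,\sigma]=0$ and $\sigma\ne\rho$, where $[\rho-\sigma]_\pm$ are the positive and negative parts of the Hermitian operator $\rho-\sigma$ and $[\rho,\sigma]=\rho\sigma-\sigma\rho$. Put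 $$D_f(\varepsilon)=(1+\varepsilon)(a_f+b_f)\!\left(\frac{\varepsilon}{1+\varepsilon}\right),\qquad \tilde a_f(\varepsilon)=\begin{cases}a_f(\varepsilon), & \varepsilon\in[0,\frac12],\\ a_f(\frac12), & \varepsilon\in(\frac12,1].\end{cases}$$ A) If $f(\rho)<+\infty$ then $$f(\sigma)\ge f(\rho)-\tilde f(\rho\wedge\varepsilon I_{\mathcal{H}})-D_f(\varepsilon)-\tilde a_f(\varepsilon)$$ for any state $\sigma\in\mathfrak{S}_0$ and $\varepsilon>0$ such that $[\rho,\sigma]=0$ and $\frac12\|\rho-\sigma\|_1\le\varepsilon\le1$. B) If either $f(\rho)<+\infty$ or $\tilde f([\rho-\varepsilon I_{\mathcal{H}}]_+)<+\infty$ for all $\varepsilon\in(0,1]$, then $$f(\sigma)\ge \tilde f([\rho-\varepsilon I_{\mathcal{H}}]_+)-D_f(\varepsilon)-\tilde a_f(\varepsilon)-a_f(1-r_\varepsilon),\qquad r_\varepsilon=\operatorname{Tr}[\rho-\varepsilon I_{\mathcal{H}}]_+,$$ for any state $\sigma\in\mathfrak{S}_0$ and $\varepsilon>0$ such that $[\rho,\sigma]=0$ and $\frac12\|\rho-\sigma\|_1\le\varepsilon\le1$.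
   Context: $\mathfrak{S}(\mathcal{H})$ is the set of quantum states on $\mathcal{H}$, i.e. positive trace-class operators with unit trace; $\|\cdot\|_1$ is the trace norm; $I_{\mathcal{H}}$ is the identity operator. For a state $\rho$ with spectral representation $\rho=\sum_i\lambda_i^\rho|\varphi_i\rangle\langle\varphi_i|$ and $\varepsilon>0$: $$\rho\wedge\varepsilon I_{\mathcal{H}}=\sum_i\min\{\lambda_i^\rho,\varepsilon\}|\varphi_i\rangle\langle\varphi_i|,\qquad [\rho-\varepsilon I_{\mathcal{H}}]_+=\sum_i\max\{\lambda_i^\rho-\varepsilon,0\}|\varphi_i\rangle\langle\varphi_i|,$$ where in $\rho\wedge\varepsilon I_{\mathcal H}$ zero eigenvalues contribute $0$. For $h:\mathbb{R}_+\to\mathbb{R}_+$ with $h(x)\le x$, $h(\rho)=\sum_i h(\lambda_i^\rho)|\varphi_i\rangle\langle\varphi_i|$. The homogeneous extension of $f$ to $\widetilde{\mathfrak{S}}_0$ is $\tilde f(\varrho)=(\operatorname{Tr}\varrho)f(\varrho/\operatorname{Tr}\varrho)$ for $\varrho\neq0$, and $\tilde f(0)=0$. *)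

(* Defs.v *)
From HB Require Import structures.
From mathcomp Require Import all_boot all_order all_algebra.
From mathcomp Require Import complex.
From mathcomp Require Import all_classical all_reals all_analysis.

Set Implicit Arguments.
Unset Strict Implicit.
Unset Printing Implicit Defensive.

Import Order.TTheory GRing.Theory Num.Theory.
Import numFieldNormedType.Exports.

Local Open Scope classical_set_scope.
Local Open Scope ring_scope.
Local Open Scope complex_scope.

Definition separable_space (T : topologicalType) : Prop :=
  exists2 D : set T, countable D & dense D.

Section HilbertSpace.
Variables (R : realType) (H : completeNormedModType R[i]).

(* MathComp forms are linear in the first argument and conjugate-linear in the
   second, so [ip x y] is <y|x> in Dirac notation. *)
Variable ip : {dot H for Num.conj}.

Definition norm_from_ip : Prop := forall x : H, ip x x = `|x| ^+ 2.

Definition bounded_op (A : H -> H) : Prop := linear A /\ continuous A.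

(* The order of R[i] makes [0 <= z] mean that z is real and nonnegative. *)
Definition positive_op (A : H -> H) : Prop := forall x, 0 <= ip (A x) x.

Definition orthonormal_basis (E : set H) : Prop :=
  (forall u v, E u -> E v -> ip u v = (u == v)%:R) /\
  (forall x, (forall u, E u -> ip x u = 0) -> x = 0).

(* The trace of a positive operator, as an element of [0, +oo]; it does not
   depend on the orthonormal basis.  It is only used on positive operators, for
   which the summands are real and nonnegative. *)
Definition Tr (A : H -> H) : \bar R :=
  \esum_(u in xget set0 orthonormal_basis) (complex.Re (ip (A u) u))%:E.

(* A positive operator with finite trace is trace class. *)
Definition is_state (A : H -> H) : Prop :=
  [/\ bounded_op A, positive_op A & Tr A = 1%E].

Definition is_adjoint (A A' : H -> H) : Prop :=
  forall x y, ip (A x) y = ip x (A' y).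

Definition is_abs_op (A B : H -> H) : Prop :=
  [/\ bounded_op B, positive_op B &
      exists2 A', is_adjoint A A' & B \o B = A' \o A].

(* |A| = (A^* A)^(1/2), unique whenever A is bounded. *)
Definition abs_op (A : H -> H) : H -> H := xget 0 (is_abs_op A).

Definition trace_norm (A : H -> H) : \bar R := Tr (abs_op A).

(* For Hermitian A. *)
Definition pos_part (A : H -> H) : H -> H := 2^-1 *: (abs_op A + A).
Definition neg_part (A : H -> H) : H -> H := 2^-1 *: (abs_op A - A).

(* [diag_op lam phi] is sum_i lam_i |phi_i><phi_i|, the series being summed in
   the strong operator topology. *)
Definition diag_series (lam : nat -> R) (phi : nat -> H) (x : H) : H ^nat :=
  series (fun i => ((lam i)%:C * ip x (phi i)) *: phi i).

Definition diag_op (lam : nat -> R) (phi : nat -> H) : H -> H :=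
  fun x => lim (diag_series lam phi x @ \oo).

(* An orthonormal system indexed by nat in which some of the vectors may be
   zero, so that finite (possibly empty) systems are included; an index with
   phi_i = 0 contributes nothing to any of the sums. *)
Definition orthonormal_system (phi : nat -> H) : Prop :=
  (forall i j, i != j -> ip (phi i) (phi j) = 0) /\
  (forall i, phi i = 0 \/ ip (phi i) (phi i) = 1).

(* The system need not be complete: the kernel of A may be left out. *)
Definition spectral_rep (A : H -> H) (s : (nat -> R) * (nat -> H)) : Prop :=
  orthonormal_system s.2 /\
  forall x, diag_series s.1 s.2 x @ \oo --> A x.

(* h(A) = sum_i h(lam_i) |phi_i><phi_i|, for h(0) = 0: this makes it independent
   of the spectral representation, in particular of whether vectors of the
   kernel of A occur in it. *)
Definition fun_op (h : R -> R) (A : H -> H) : H -> H :=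
  let s := xget (fun=> 0, fun=> 0) (spectral_rep A) in diag_op (h \o s.1) s.2.

Definition wedge_op (A : H -> H) (eps : R) : H -> H :=
  fun_op (fun x => Num.min x eps) A.

Definition cut_op (A : H -> H) (eps : R) : H -> H :=
  fun_op (fun x => Num.max (x - eps) 0) A.

Definition cone (S : set (H -> H)) : set (H -> H) :=
  [set A | exists c rho, [/\ 0 <= c, S rho & A = c%:C *: rho]].

Definition mix (p : R) (rho sigma : H -> H) : H -> H :=
  p%:C *: rho + (1 - p)%:C *: sigma.

(* In \bar R, 0 * +oo = 0, so the inequalities are trivial for p = 0 and p = 1;
   only the values of f on S matter. *)
Definition almost_affine (S : set (H -> H)) (a b : R -> R)
    (f : (H -> H) -> \bar R) : Prop :=
  forall rho sigma p, S rho -> S sigma -> 0 <= p <= 1 ->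
    (p%:E * f rho + (1 - p)%:E * f sigma - (a p)%:E <= f (mix p rho sigma))%E /\
    (f (mix p rho sigma) <= p%:E * f rho + (1 - p)%:E * f sigma + (b p)%:E)%E.

Definition homogeneous_ext (f : (H -> H) -> \bar R) (A : H -> H) : \bar R :=
  if A == 0 then 0%E else (Tr A * f ((fine (Tr A))^-1%:C *: A))%E.

End HilbertSpace.

Section Moduli.
Variable R : realType.

Definition modulus (a : R -> R) : Prop :=
  [/\ {within `[0, 1], continuous a},
      a 0 = 0,
      {in `[0, 1], forall p, a p = a (1 - p)},
      {in `[0, 2^-1] &, forall x y, forall t, 0 <= t <= 1 ->
         t * a x + (1 - t) * a y <= a (t * x + (1 - t) * y)} &
      {in `[0, 2^-1] &, {homo a : x y / x <= y}}].

Definition Dfun (a b : R -> R) (eps : R) : R :=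
  (1 + eps) * (a \+ b) (eps / (1 + eps)).

Definition flat_ext (a : R -> R) (eps : R) : R :=
  if eps <= 2^-1 then a eps else a 2^-1.

End Moduli.

(* Main.v *)
Require Import Defs.
From HB Require Import structures.
From mathcomp Require Import all_boot all_order all_algebra.
From mathcomp Require Import ring lra.
From mathcomp Require Import complex.
From mathcomp Require Import all_classical all_reals all_analysis.

(* For commuting rho and sigma put D = [rho - sigma]_+ and N = [rho - sigma]_-, both of
   trace delta = |rho - sigma|_1 / 2 <= eps.  Normalizing rho + N = sigma + D writes one
   state as a mixture in two ways, which bounds f(rho) - f(sigma) by f~(D) + D_f(eps).
   In a joint eigenbasis no eigenvalue of rho - sigma exceeds delta, so that
   Theta := rho /\ eps - D is positive; if Theta lies in the cone, then
   rho /\ eps = D + Theta bounds f~(D) by f~(rho /\ eps) up to flat_ext a eps, which is A).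
   Moreover sigma = [rho - eps]_+ + (N + Theta), and B) follows from the lower inequality
   for this sum alone, whether or not f(rho) is finite.

   That Theta lies in the cone is where (a) and (b) are used: (b) is applied to auxiliary
   states, mixtures of D and of functions of rho, for which the positive part
   reproduces Theta on a prescribed part A of the spectrum and vanishes on the rest,
   the values on the rest being adjusted to get trace 1.  This needs A and its complement
   to be both cut out by elements of the cone. *)

Set Implicit Arguments.
Unset Strict Implicit.
Unset Printing Implicit Defensive.

Import Order.TTheory GRing.Theory Num.Theory.
Import numFieldNormedType.Exports.

Local Open Scope classical_set_scope.
Local Open Scope ring_scope.
Local Open Scope complex_scope.

Local Notation Re := complex.Re.
Local Notation Im := complex.Im.

(** The constants come from homogeneity. On the cone the hypotheses on f become f~(A) + f~(B) - t
    a(p) <= f~(A + B) <= f~(A) + f~(B) + t b(p), with t = Tr(A + B) and p = Tr A / t. For N + rho =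
    D + sigma one has t = 1 + delta and p = delta / (1 + delta), whence D_f; for D + Theta the error
    is t a(delta / t) with t = Tr(rho /\ eps) <= 1, and concavity of a bounds it by
    [flat_ext a eps].

    The obstacle is that a positive difference of two elements of the cone need not lie in it: (b)
    only gives the parts of rho minus a state, and Theta, depending on sigma through D, is not a
    function of rho. Working on a part of the spectrum leaves the other part free to absorb the
    trace. An eigenspace provides the splitting when rho has two distinct positive eigenvalues, but
    not when rho is a multiple of a projection. In that case a splitting set is found by descent on
    supports, which terminates because a positive eigenvalue of a trace-class operator has finite
    multiplicity. *)

Lemma sub_count_lt (T : eqType) (a b : pred T) (s : seq T) (t : T) :
  subpred a b -> t \in s -> b t -> ~~ a t -> (count a s < count b s)%N.
Proof.
move=> ab + bt nat; elim: s => //= y s IH; rewrite inE => /orP[/eqP<-|/IH lt].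
  by rewrite bt (negPf nat) add0n add1n ltnS sub_count.
rewrite -addnS leq_add//; case aby: (a y) => //.
by rewrite (ab _ aby).
Qed.

(** * The cone of operators diagonal in a joint eigenbasis *)

(* [T] indexes a joint eigenbasis and a function on [T] is the sequence of
   eigenvalues of an operator diagonal in it: [l] is that of rho, [C] consists
   of those of the operators of the cone, and [tr] is the trace. *)
Section SpectralCone.
Variables (R : realType) (T : eqType) (C : set (T -> R)) (tr : (T -> R) -> R).
Variable l : T -> R.
Hypothesis C_ge0 : forall g, C g -> forall t, 0 <= g t.
Hypothesis C_lin : forall x y g g', 0 <= x -> 0 <= y -> C g -> C g' ->
  C (fun t => x * g t + y * g' t).
Hypothesis C_fun : forall h : R -> R, (forall x, 0 <= x -> 0 <= h x <= x) ->
  C (fun t => h (l t)).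
Hypothesis C_parts : forall g, C g -> tr g = 1 -> g <> l ->
  C (fun t => Num.max (l t - g t) 0) /\ C (fun t => Num.max (g t - l t) 0).
Hypothesis tr_lin : forall x y g g', 0 <= x -> 0 <= y -> C g -> C g' ->
  tr (fun t => x * g t + y * g' t) = x * tr g + y * tr g'.
Hypothesis tr_gt0 : forall g t, C g -> 0 < g t -> 0 < tr g.
Hypothesis tr_le : forall g g', C g -> C g' -> (forall t, g t <= g' t) ->
  tr g <= tr g'.
Hypothesis tr_l : tr l = 1.
(** The eigenvalues of a trace-class operator tend to 0. This provides the finite set on which
    [indicator_of_vanishing] counts. *)
Hypothesis l_finite : forall v, 0 < v ->
  exists s : seq T, forall t, v <= l t -> t \in s.

Let C_l : C l.
Proof. by have := C_fun (h := id); apply => x x0; rewrite x0 lexx. Qed.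

Let l_ge0 t : 0 <= l t. Proof. exact: C_ge0 C_l t. Qed.

Let C_scale x g : 0 <= x -> C g -> C (fun t => x * g t).
Proof.
move=> x0 Cg; have := C_lin x0 (lexx 0) Cg Cg; congr C.
by apply/funext => t; rewrite mul0r addr0.
Qed.

Let tr_scale x g : 0 <= x -> C g -> tr (fun t => x * g t) = x * tr g.
Proof.
move=> x0 Cg; rewrite -[RHS]addr0 -[X in _ + X](mul0r (tr g)) -tr_lin//.
by congr tr; apply/funext => t; rewrite mul0r addr0.
Qed.

Let C_add g g' : C g -> C g' -> C (fun t => g t + g' t).
Proof.
move=> Cg Cg'; have := C_lin ler01 ler01 Cg Cg'; congr C.
by apply/funext => t; rewrite !mul1r.
Qed.

Let tr_add g g' : C g -> C g' -> tr (fun t => g t + g' t) = tr g + tr g'.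
Proof.
move=> Cg Cg'; rewrite -[tr g]mul1r -[tr g']mul1r -tr_lin//.
by congr tr; apply/funext => t; rewrite !mul1r.
Qed.

Let C_0 : C (fun=> 0).
Proof. by have := C_scale (lexx 0) C_l; congr C; apply/funext => t; rewrite mul0r. Qed.

Section Splitting.
Variable A : pred T.
Let lA t := if A t then l t else 0.
Let lB t := if ~~ A t then l t else 0.
Hypotheses (C_lA : C lA) (C_lB : C lB).
Hypotheses (A_pos : exists2 t, A t & 0 < l t).
Hypotheses (B_pos : exists2 t, ~~ A t & 0 < l t).

Let tr_lA : 0 < tr lA.
Proof. by case: A_pos => t At lt; apply: (tr_gt0 (t := t)) => //; rewrite /lA At. Qed.

Let tr_lB : 0 < tr lB.
Proof.
by case: B_pos => t At lt; apply: (tr_gt0 (t := t)) => //; rewrite /lB (negPf At).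
Qed.

Let tr_split : tr lA + tr lB = 1.
Proof.
rewrite -tr_add// -[RHS]tr_l; congr tr; apply/funext => t.
by rewrite /lA /lB; case: (A t); rewrite ?addr0 ?add0r.
Qed.

(* The state [g] equal to [l - M + X] on [A] and to [X + (1 + w) l] off [A], with
   [w] chosen so that its trace is 1, has [(l - g)_+ = (M - X) 1_A]. *)
Lemma restricted_complement M X : C M -> C (fun t => lA t - M t) ->
  C X -> (forall t, A t -> X t <= M t) -> tr X <= tr M ->
  C (fun t => if A t then M t - X t else 0).
Proof.
move=> CM ClM CX XM trXM.
have MA t : ~~ A t -> M t = 0.
  move=> At; have := C_ge0 ClM t; rewrite /lA (negPf At) sub0r oppr_ge0 => M0.
  by apply/eqP; rewrite eq_le M0 C_ge0.
pose w := (tr M - tr X) / tr lB.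
have w0 : 0 <= w by rewrite divr_ge0 ?subr_ge0// ltW.
pose g t := ((lA t - M t) + X t) + (1 + w) * lB t.
have Cg : C g by apply: C_add; [apply: C_add|apply: C_scale => //; lra].
have trg : tr g = 1.
  have w1 : 0 <= 1 + w by lra.
  have trE : tr lA = tr (fun t => lA t - M t) + tr M.
    by rewrite -tr_add//; congr tr; apply/funext => t; rewrite subrK.
  have -> : tr g = tr (fun t => lA t - M t) + tr X + (1 + w) * tr lB.
    rewrite -(tr_scale w1 C_lB) -(tr_add ClM CX) -tr_add//; first exact: C_add.
    exact: C_scale.
  by rewrite mulrDl mul1r /w divfK ?gt_eqF//; move: tr_split; rewrite trE => h; lra.
have gE t : A t -> l t - g t = M t - X t.
  by move=> At; rewrite /g /lB /lA At /= mulr0; lra.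
(* (b) excludes [g = l]; in that case [M = X] on [A] and the function in question is zero. *)
have [gl|gl] := pselect (g = l).
  move: C_0; congr C; apply/funext => t; case: ifPn => // At.
  by rewrite -gE// gl subrr.
have [+ _] := C_parts Cg trg gl; congr C; apply/funext => t; case: ifPn => At.
  by rewrite gE// max_l// subr_ge0 XM.
rewrite max_r// /g /lA /lB (negPf At) MA//=.
have := l_ge0 t; have := C_ge0 CX t; have := mulr_ge0 w0 (l_ge0 t); lra.
Qed.

(* Three applications of [restricted_complement]: first [l 1_A - k D 1_A], then its
   complement [k D 1_A], and finally [(m - D) 1_A]; the factor [k] makes the
   trace condition of the first one hold. *)
Lemma restrict_diff m D : C (fun t => if A t then m t else 0) ->
  C (fun t => if A t then l t - m t else 0) ->
  C D -> (forall t, D t <= m t) -> (forall t, m t <= l t) ->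
  C (fun t => if A t then m t - D t else 0).
Proof.
move=> Cm Clm CD Dm ml; pose k := tr lA.
have k0 : 0 < k := tr_lA.
have k1 : k <= 1 by rewrite -tr_split lerDl ltW.
have Dl t : D t <= l t by exact: le_trans (Dm t) (ml t).
have CkD : C (fun t => k * D t) by apply: C_scale => //; exact: ltW.
have kDl t : k * D t <= l t.
  by apply: le_trans (Dl t); rewrite ler_piMl// C_ge0.
have ClA0 : C (fun t => lA t - lA t).
  by move: C_0; congr C; apply/funext => t; rewrite subrr.
(* For [M = lA] and [X = k D] the trace condition reads [k * tr D <= tr lA]; this is why [k] is
   [tr lA]. *)
have trD : tr D <= 1 by rewrite -tr_l; exact: tr_le.
have CX1 : C (fun t => if A t then lA t - k * D t else 0).
  apply: restricted_complement => //; first by move=> t At; rewrite /lA At.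
  by rewrite (tr_scale (ltW k0) CD) -[leRHS]mulr1 ler_wpM2l// ltW.
have CDA : C (fun t => if A t then D t else 0).
  have CkDA : C (fun t => if A t then k * D t else 0).
    have X1l t : (if A t then lA t - k * D t else 0) <= lA t.
      rewrite /lA; case: (A t) => //.
      by rewrite lerBlDr lerDl mulr_ge0 ?C_ge0// ltW.
    have := restricted_complement C_lA ClA0 CX1 (fun t _ => X1l t) (tr_le CX1 C_lA X1l).
    congr C; apply/funext => t; rewrite /lA; case: (A t) => //.
    by rewrite opprB addrC subrK.
  have k'0 : 0 <= k^-1 by rewrite invr_ge0 ltW.
  have := C_scale k'0 CkDA; congr C; apply/funext => t.
  by case: (A t); rewrite ?mulr0// mulKf// gt_eqF.
have DAm t : (if A t then D t else 0) <= if A t then m t else 0.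
  by case: (A t).
have ClmA : C (fun t => lA t - if A t then m t else 0).
  by move: Clm; congr C; apply/funext => t; rewrite /lA; case: (A t); rewrite ?subrr.
have := restricted_complement Cm ClmA CDA (fun t _ => DAm t) (tr_le CDA Cm DAm).
by congr C; apply/funext => t; case: (A t).
Qed.
End Splitting.

Let normalized g : C g -> 0 < tr g ->
  C (fun t => (tr g)^-1 * g t) /\ tr (fun t => (tr g)^-1 * g t) = 1.
Proof.
move=> Cg g0; have g0' : 0 <= (tr g)^-1 by rewrite invr_ge0 ltW.
by split; [exact: C_scale|rewrite tr_scale// mulVf// gt_eqF].
Qed.

Let ex_gt0 g : C g -> 0 < tr g -> exists t, 0 < g t.
Proof.
move=> Cg; apply: contraPP => /forallNP g0; rewrite (_ : g = fun t => 0 * l t).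
  by rewrite tr_scale// mul0r ltxx.
apply/funext => t; rewrite mul0r; apply/eqP; move: (g0 t) => /negP.
by rewrite -leNgt eq_le C_ge0// andbT.
Qed.

(** Since [g] and [l] have the same trace, so do the two parts of [l - g]; if one of them vanished,
    both would, and [g] would be [l]. *)
Let parts_gt0 g : C g -> tr g = 1 -> g <> l ->
  (exists t, g t < l t) /\ (exists t, l t < g t).
Proof.
move=> Cg trg gl; have [CD CN] := C_parts Cg trg gl.
have trDN : tr (fun t => Num.max (l t - g t) 0) = tr (fun t => Num.max (g t - l t) 0).
  apply: (addIr (tr g)); rewrite -tr_add// trg -tr_l -tr_add//; congr tr.
  apply/funext => t; have [h|h] := leP (l t - g t) 0;
    by have [h'|h'] := leP (g t - l t) 0; lra.
have trN : 0 < tr (fun t => Num.max (g t - l t) 0).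
  have [t gt] : exists t, g t != l t.
    apply: contrapT => /forallNP h; apply: gl; apply/funext => t.
    by move: (h t) => /negP; rewrite negbK => /eqP.
  move: gt; rewrite neq_lt => /orP[gt|gt].
    by rewrite -trDN; apply: (tr_gt0 (t := t)) => //; rewrite lt_max subr_gt0 gt.
  by apply: (tr_gt0 (t := t)) => //; rewrite lt_max subr_gt0 gt.
split.
  have [|t] := ex_gt0 CD; first by rewrite trDN.
  by rewrite lt_max ltxx orbF subr_gt0; exists t.
have [t] := ex_gt0 CN trN.
by rewrite lt_max ltxx orbF subr_gt0; exists t.
Qed.

(** Normalizing [l 1_A] divides it by a trace at most 1, so the result dominates [l] on [A] and
    vanishes off [A]: the positive part in (b) is exactly [l] off [A]. *)
Let C_complement A : C (fun t => if A t then l t else 0) ->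
  (exists2 t, A t & 0 < l t) ->
  C (fun t => if ~~ A t then l t else 0).
Proof.
set lA := fun t => if A t then l t else 0; move=> CA [t0 At0 lt0].
have tr0 : 0 < tr lA by apply: (tr_gt0 (t := t0)) => //; rewrite /lA At0.
have tr1 : tr lA <= 1.
  by rewrite -tr_l; apply: tr_le => // t; rewrite /lA; case: (A t).
have [Cg trg] := normalized CA tr0; set g := fun t => _ in Cg trg.
have [gl|gl] := pselect (g = l).
  move: C_0; congr C; apply/funext => t; case: ifPn => // At.
  by rewrite -gl /g /lA (negPf At) mulr0.
have [+ _] := C_parts Cg trg gl; congr C; apply/funext => t; rewrite /g /lA.
case: (A t); last by rewrite mulr0 subr0 max_l.
by rewrite max_r// subr_le0 ler_peMl// invf_ge1.
Qed.

(* By induction on the support of [X]: the support of [(g - l)_+], where [g] is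
   [X] normalized, is contained in that of [X], and if it is not smaller then
   [(l - g)_+] is the restriction of [l] to the complement of this support. *)
Let indicator_of_vanishing (s : seq T) : (forall t, 0 < l t -> t \in s) ->
  forall X, C X -> (forall t, 0 < X t -> 0 < l t) -> (exists t, 0 < X t) ->
  (exists2 t, 0 < l t & X t = 0) ->
  exists A : pred T, [/\ C (fun t => if A t then l t else 0),
    exists2 t, A t & 0 < l t & exists2 t, ~~ A t & 0 < l t].
Proof.
move=> ls X; have [n] := ubnP (count (fun t => 0 < X t) s).
elim: n X => // n IH X; rewrite ltnS => cX CX Xl [t1 X1] [t2 l2 X2].
have trX : 0 < tr X by exact: tr_gt0 X1.
have [Cg trg] := normalized CX trX; set g := fun t => _ in Cg trg.
have gl : g <> l.
  by move=> /(congr1 (@^~ t2)); rewrite /g X2 mulr0 => l2'; rewrite -l2' ltxx in l2.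
have gX t : (0 < g t) = (0 < X t) by rewrite pmulr_rgt0// invr_gt0.
have [CD CN] := C_parts Cg trg gl.
have NX t : 0 < Num.max (g t - l t) 0 -> 0 < X t.
  by rewrite lt_max ltxx orbF subr_gt0 => /(le_lt_trans (l_ge0 t)); rewrite gX.
have [[t3 X3 gt3]|all_gt] := pselect (exists2 t, 0 < X t & g t <= l t).
  apply: (IH _ _ CN).
  - apply: leq_trans cX; apply: (@sub_count_lt _ _ _ s t3) => //.
    + exact/ls/Xl.
    + by rewrite lt_max ltxx orbF subr_gt0 ltNge gt3.
  - by move=> t /NX/Xl.
  - have [_ [t gt]] := parts_gt0 Cg trg gl.
    by exists t; rewrite lt_max subr_gt0 gt.
  - by exists t3; [exact: Xl|rewrite max_r// subr_le0].
exists (fun t => ~~ (0 < X t)); split.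
- move: CD; congr C; apply/funext => t; case: ltP => Xt /=.
    apply: max_r; rewrite subr_le0 ltW// ltNge; apply/negP => h.
    by apply: all_gt; exists t.
  have -> : g t = 0.
    by rewrite /g (_ : X t = 0) ?mulr0//; apply/eqP; rewrite eq_le Xt C_ge0.
  by rewrite subr0 max_l.
- by exists t2 => //; rewrite X2 ltxx.
- by exists t1; [rewrite negbK|exact: Xl].
Qed.

Lemma min_sub_pos_part mu eps : 0 < eps -> C mu -> tr mu = 1 ->
  (forall t, l t - mu t <= eps) ->
  C (fun t => Num.min (l t) eps - Num.max (l t - mu t) 0).
Proof.
(* [restrict_diff] is applied to a set [A] and to its complement.  If [l] takes two
   distinct positive values then [A] is one of its level sets; otherwise all the
   functions of [l] are proportional and [A] is extracted from [D], unless [D]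
   is proportional to [l] too. *)
move=> e0 Cmu trmu le_eps.
have Cm : C (fun t => Num.min (l t) eps).
  by apply: (C_fun (h := Num.min ^~ eps)) => x x0; rewrite le_min x0 ltW//= ge_min lexx.
have [->|mul] := pselect (mu = l).
  move: Cm; congr C; apply/funext => t.
  by rewrite subrr max_l// subr0.
pose m t := Num.min (l t) eps; pose D t := Num.max (l t - mu t) 0.
have [CD CN] := C_parts Cmu trmu mul.
(* [le_eps] bounds [D] by [eps], and [mu >= 0] bounds it by [l]. *)
have Dm t : D t <= m t.
  rewrite ge_max !le_min le_eps lerBlDr lerDl C_ge0//=.
  by rewrite l_ge0 ltW.
have ml t : m t <= l t by rewrite ge_min lexx.
have splitting (A : pred T) : C (fun t => if A t then m t else 0) ->
  C (fun t => if ~~ A t then m t else 0) ->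
  C (fun t => if A t then l t - m t else 0) ->
  C (fun t => if ~~ A t then l t - m t else 0) ->
  C (fun t => if A t then l t else 0) ->
  C (fun t => if ~~ A t then l t else 0) ->
  (exists2 t, A t & 0 < l t) -> (exists2 t, ~~ A t & 0 < l t) ->
  C (fun t => m t - D t).
  move=> CmA CmB ClmA ClmB ClA ClB A_pos B_pos.
  have CA := restrict_diff ClA ClB A_pos B_pos CmA ClmA CD Dm ml.
  have CB : C (fun t => if ~~ A t then m t - D t else 0).
    have ClA' : C (fun t => if ~~ ~~ A t then l t else 0).
      by move: ClA; congr C; apply/funext => t; rewrite negbK.
    apply: (restrict_diff (A := predC A) ClB ClA' B_pos) => //.
    by have [t At lt] := A_pos; exists t; rewrite //= negbK.
  have := C_add CA CB; congr C; apply/funext => t.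
  by case: (A t); rewrite ?addr0 ?add0r.
have [[t1 [t2 [l1 l2 l12]]]|single] :=
    pselect (exists t1 t2, [/\ 0 < l t1, 0 < l t2 & l t1 != l t2]).
  have hC h : (forall x, 0 <= x -> 0 <= h x <= x) ->
      C (fun t => if l t == l t1 then h (l t) else 0) /\
      C (fun t => if l t != l t1 then h (l t) else 0).
    move=> hh; split.
      apply: (C_fun (h := fun x => if x == l t1 then h x else 0)) => x x0.
      by case: ifP => _; [exact: hh|rewrite lexx].
    apply: (C_fun (h := fun x => if x != l t1 then h x else 0)) => x x0.
    by case: ifP => _; [exact: hh|rewrite lexx].
  have hm x : 0 <= x -> 0 <= Num.min x eps <= x.
    by move=> x0; rewrite le_min x0 ltW//= ge_min lexx.
  have hlm x : 0 <= x -> 0 <= x - Num.min x eps <= x.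
    by move=> x0; rewrite subr_ge0 lerBlDr lerDl le_min x0 (ltW e0) ge_min lexx.
  have hid (x : R) : 0 <= x -> 0 <= id x <= x by move=> x0; rewrite x0 lexx.
  have [CmA CmB] := hC _ hm; have [ClmA ClmB] := hC _ hlm.
  have [ClA ClB] := hC id hid.
  apply: (splitting (fun t => l t == l t1)) => //.
  - by exists t1.
  - by exists t2 => //; rewrite eq_sym.
have [t0 l0] : exists t, 0 < l t.
  have : 0 < tr l by rewrite tr_l.
  apply: contraPP => /forallNP l0; rewrite (_ : l = fun t => 0 * l t).
    by rewrite tr_scale// mul0r ltxx.
  apply/funext => t; rewrite mul0r; apply/eqP; move: (l0 t) => /negP.
  by rewrite -leNgt eq_le l_ge0 andbT.
have l0v t : l t = 0 \/ l t = l t0.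
  have [lt|] := ltP 0 (l t); last by move=> lt; left; apply/eqP; rewrite eq_le lt l_ge0.
  right; apply/eqP; apply: contrapT => /negP neq.
  by apply: single; exists t, t0.
(* As [l] takes only the values 0 and [l t0], a function of [l] vanishing at 0 is a multiple of
   [l]. *)
have C_scaled (A : pred T) (h : R -> R) (h0 : 0 <= h (l t0)) : h 0 = 0 ->
    C (fun t => if A t then l t else 0) -> C (fun t => if A t then h (l t) else 0).
  move=> hz CA; have c0 : 0 <= h (l t0) / l t0 by rewrite divr_ge0// ltW.
  have := C_scale c0 CA; congr C; apply/funext => t.
  case: (A t); rewrite ?mulr0//.
  by have [->|->] := l0v t; [rewrite mulr0 hz|rewrite divfK// gt_eqF].
have [Dconst|] := pselect (forall t, 0 < l t -> D t = D t0).
  have Dmt0 := Dm t0.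
  have c0 : 0 <= (m t0 - D t0) / l t0 by rewrite divr_ge0 ?(ltW l0)// subr_ge0.
  have := C_scale c0 C_l; congr C; apply/funext => t.
  have [lt|lt] := l0v t.
    rewrite lt mulr0 min_l ?(ltW e0)// max_r ?subrr//.
    by rewrite sub0r oppr_le0 C_ge0.
  have -> : l t = l t0 by [].
  have := Dconst t; rewrite lt => /(_ l0); rewrite /D lt => ->.
  by rewrite divfK ?gt_eqF.
move=> /existsNP[t1 /not_implyP[l1 D1]].
(* [l t0] is the only positive value of [l], so [s] contains the whole support of [l]. *)
have [s hs] := l_finite l0.
have [A [CA A_pos B_pos]] : exists A : pred T, [/\ C (fun t => if A t then l t else 0),
    exists2 t, A t & 0 < l t & exists2 t, ~~ A t & 0 < l t].
  have Dsupp t : 0 < D t -> 0 < l t.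
    by rewrite lt_max ltxx orbF subr_gt0; exact: le_lt_trans (C_ge0 Cmu t).
  have trD : 0 < tr D.
    have [D0|D0] := ltP 0 (D t0); first exact: tr_gt0 D0.
    apply: (tr_gt0 (t := t1)) => //; rewrite lt_neqAle C_ge0// andbT eq_sym.
    apply/eqP => D1'; apply: D1; rewrite D1'; apply/eqP.
    by rewrite eq_le D0 C_ge0.
  (* [D] may be positive on the whole support of [l]. Its normalization [g] differs from [l], not
     being constant there, and [(g - l)_+] vanishes where [g < l], as the descent requires. *)
  have [Cg trg] := normalized CD trD; set g := fun t => _ in Cg trg.
  have g01 : g t0 != g t1.
    apply/eqP => /mulfI; rewrite invr_eq0 gt_eqF// => /(_ isT) E.
    by apply: D1; exact: esym E.
  have ll : l t1 = l t0 by have [l1'|//] := l0v t1; rewrite l1' ltxx in l1.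
  have gl : g <> l by move=> gl; move: g01; rewrite gl ll eqxx.
  have [_ CgN] := C_parts Cg trg gl.
  have gsupp t : 0 < g t -> 0 < l t by rewrite pmulr_rgt0 ?invr_gt0//; exact: Dsupp.
  have [[t2 lt2] [t3 gt3]] := parts_gt0 Cg trg gl.
  apply: (indicator_of_vanishing (s := s) _ CgN).
  - by move=> t lt; apply: hs; have [lt'|->//] := l0v t; rewrite lt' ltxx in lt.
  - move=> t; rewrite lt_max ltxx orbF subr_gt0 => /(le_lt_trans (l_ge0 t)).
    exact: gsupp.
  - by exists t3; rewrite lt_max subr_gt0 gt3.
  - exists t2; first by apply: le_lt_trans lt2; exact: C_ge0.
    by rewrite max_r// subr_le0 ltW.
have CB := C_complement CA A_pos.
have m0 : Num.min 0 eps = 0 by rewrite min_l// ltW.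
have hm0 : 0 <= Num.min (l t0) eps by rewrite le_min l_ge0 ltW.
have hlm0 : 0 <= l t0 - Num.min (l t0) eps by rewrite subr_ge0 ge_min lexx.
apply: (splitting A) => //.
- exact: (C_scaled A (Num.min ^~ eps)).
- exact: (C_scaled (predC A) (Num.min ^~ eps)).
- by apply: (C_scaled A (fun x => x - Num.min x eps)) => //; rewrite m0 subrr.
- by apply: (C_scaled (predC A) (fun x => x - Num.min x eps)) => //; rewrite m0 subrr.
Qed.
End SpectralCone.

(** * Inner products and positive operators *)

Section ComplexNumbers.
Variable R : realType.
Implicit Types z w : R[i].

(** The norm of [R[i]] takes values in [R[i]]; estimates are made on squared norms in [R], where
    [lra] and real series are available. *)
Definition sqnorm z : R := Re z ^+ 2 + Im z ^+ 2.

Lemma sqnormE z : (sqnorm z)%:C = `|z| ^+ 2.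
Proof. exact: add_Re2_Im2. Qed.

Lemma sqnorm_ge0 z : 0 <= sqnorm z.
Proof. by rewrite addr_ge0// sqr_ge0. Qed.

Lemma sqnorm_eq0 z : sqnorm z = 0 -> z = 0.
Proof.
move=> z0; apply/eqP; rewrite -normr_eq0 -sqrf_eq0 -sqnormE z0.
by [].
Qed.

Lemma ReD z w : Re (z + w) = Re z + Re w. Proof. by case: z w => [? ?] []. Qed.
Lemma ReN z : Re (- z) = - Re z. Proof. by case: z. Qed.
Lemma ReB z w : Re (z - w) = Re z - Re w. Proof. by rewrite ReD ReN. Qed.
Lemma ImD z w : Im (z + w) = Im z + Im w. Proof. by case: z w => [? ?] []. Qed.
Lemma ImN z : Im (- z) = - Im z. Proof. by case: z. Qed.
Lemma ReM z w : Re (z * w) = Re z * Re w - Im z * Im w.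
Proof. by case: z w => [? ?] []. Qed.
Lemma ImM z w : Im (z * w) = Re z * Im w + Im z * Re w.
Proof. by case: z w => [? ?] []. Qed.
Lemma ReZ (r : R) z : Re (r%:C * z) = r * Re z.
Proof. by rewrite ReM/= mul0r subr0. Qed.
Lemma ReJ z : Re (Num.conj z) = Re z. Proof. by case: z. Qed.
Lemma ImJ z : Im (Num.conj z) = - Im z. Proof. by case: z. Qed.
Lemma conj_realC (r : R) : Num.conj r%:C = r%:C :> R[i].
Proof. by apply/eqP; rewrite eq_complex ReJ ImJ/= oppr0 !eqxx. Qed.
Lemma complexP z w : Re z = Re w -> Im z = Im w -> z = w.
Proof. by case: z w => [? ?] [? ?] /= -> ->. Qed.
Lemma ge0_realC z : 0 <= z -> z = (Re z)%:C.
Proof. by move=> z0; rewrite RRe_real// ger0_real. Qed.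
Lemma mulC_conj z : z * Num.conj z = (sqnorm z)%:C.
Proof. by rewrite sqnormE normCK. Qed.
Lemma Re_sum (I : Type) (s : seq I) (P : pred I) (F : I -> R[i]) :
  Re (\sum_(i <- s | P i) F i) = \sum_(i <- s | P i) Re (F i).
Proof. by elim/big_rec2: _ => // i x y _ <-; rewrite ReD. Qed.
Lemma sqnorm_real (r : R) : sqnorm r%:C = r ^+ 2.
Proof. by rewrite /sqnorm /= expr0n addr0. Qed.
Lemma sqnorm_conj z : sqnorm (Num.conj z) = sqnorm z.
Proof. by rewrite /sqnorm ReJ ImJ sqrrN. Qed.
End ComplexNumbers.

Section InnerProduct.
Variables (R : realType) (H : completeNormedModType R[i]).
Variable ip : {dot H for Num.conj}.
Hypothesis ip_norm : norm_from_ip ip.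
Implicit Types (x y u v : H) (A : H -> H).

Lemma ipC x y : ip x y = Num.conj (ip y x).
Proof. by rewrite hermC /= expr0 mul1r. Qed.

Lemma ipDl x y u : ip (x + y) u = ip x u + ip y u.
Proof. exact: linearDl. Qed.
Lemma ipBl x y u : ip (x - y) u = ip x u - ip y u.
Proof. exact: linearBl. Qed.
Lemma ipDr x y u : ip u (x + y) = ip u x + ip u y.
Proof. exact: linearDr. Qed.
Lemma ipBr x y u : ip u (x - y) = ip u x - ip u y.
Proof. exact: linearBr. Qed.
Lemma ipZl a x y : ip (a *: x) y = a * ip x y.
Proof. exact: linearZl_LR. Qed.
Lemma ipZr a x y : ip x (a *: y) = Num.conj a * ip x y.
Proof. exact: linearZr_LR. Qed.
Lemma ip0l x : ip 0 x = 0. Proof. exact: linear0l. Qed.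
Lemma ip0r x : ip x 0 = 0. Proof. exact: linear0r. Qed.
Lemma ip_suml I (r : seq I) (P : pred I) (E : I -> H) z :
  ip (\sum_(i <- r | P i) E i) z = \sum_(i <- r | P i) ip (E i) z.
Proof. exact: linear_sumlz. Qed.
Lemma ip_sumr I (r : seq I) (P : pred I) (E : I -> H) z :
  ip z (\sum_(i <- r | P i) E i) = \sum_(i <- r | P i) ip z (E i).
Proof. exact: linear_sumr. Qed.

Definition ip_sqnorm x : R := Re (ip x x).
Local Notation hsq := ip_sqnorm.

Lemma hsqE x : (hsq x)%:C = ip x x.
Proof. by rewrite /ip_sqnorm -ge0_realC// dnorm_ge0. Qed.

Lemma hsq_norm x : (hsq x)%:C = `|x| ^+ 2.
Proof. by rewrite hsqE ip_norm. Qed.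

Lemma hsq_ge0 x : 0 <= hsq x.
Proof. by rewrite -ler0c hsqE dnorm_ge0. Qed.

Lemma hsq_eq0 x : hsq x = 0 -> x = 0.
Proof. by move=> x0; apply/eqP; rewrite -(dnorm_eq0 ip) -hsqE x0. Qed.

Lemma hsqZ a x : hsq (a *: x) = sqnorm a * hsq x.
Proof. by apply: complexI; rewrite hsq_norm normrZ exprMn -sqnormE -hsq_norm rmorphM. Qed.

Lemma hsqN x : hsq (- x) = hsq x.
Proof. by apply: complexI; rewrite !hsq_norm normrN. Qed.

Lemma hsqBC x y : hsq (x - y) = hsq (y - x).
Proof. by rewrite -hsqN opprB. Qed.

Lemma sqnorm_ipC x y : sqnorm (ip x y) = sqnorm (ip y x).
Proof. by rewrite ipC sqnorm_conj. Qed.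

Section Linear.
Variable A : H -> H.
Hypothesis linA : linear A.
Lemma lin_op0 : A 0 = 0.
Proof. by have := linA (-1) 0 0; rewrite scaler0 addr0 scaleN1r addNr. Qed.
Lemma lin_opD x y : A (x + y) = A x + A y.
Proof. by rewrite -[x]scale1r linA !scale1r. Qed.
Lemma lin_opZ a x : A (a *: x) = a *: A x.
Proof. by rewrite -[a *: x]addr0 linA lin_op0 addr0. Qed.
Lemma lin_opN x : A (- x) = - A x.
Proof. by rewrite -scaleN1r lin_opZ scaleN1r. Qed.
Lemma lin_opB x y : A (x - y) = A x - A y.
Proof. by rewrite lin_opD lin_opN. Qed.

Hypothesis posA : positive_op ip A.

(** Polarization: the quadratic form is real at [x + y] and at [x + 'i y], which compares the
    imaginary and then the real parts of the two sides. *)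
Lemma positive_symmetric x y : ip (A x) y = ip x (A y).
Proof.
rewrite [RHS]ipC; set p := ip (A x) y; set q := ip (A y) x.
have h z : Im (ip (A z) z) = 0 by exact: ger0_Im.
have h1 := h (x + y); have h2 := h (x + 'i%C *: y).
rewrite lin_opD ipDl !ipDr !ImD !h add0r addr0 -/p -/q in h1.
rewrite lin_opD lin_opZ ipDl !ipDr !ipZl !ipZr !ImD !ImM !ReM !h -/p -/q in h2.
move: h2; rewrite ReJ ImJ /= => h2.
by apply: complexP; rewrite ?ReJ ?ImJ; lra.
Qed.

Lemma positive_CauchySchwarz x y :
  sqnorm (ip (A x) y) <= Re (ip (A x) x) * Re (ip (A y) y).
Proof.
set p := ip (A x) y; set a := Re (ip (A x) x); set c := Re (ip (A y) y).
have a0 : 0 <= a by rewrite -ler0c /a -ge0_realC.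
have c0 : 0 <= c by rewrite -ler0c /c -ge0_realC.
have key r : 0 <= a - 2 * r * sqnorm p + r ^+ 2 * sqnorm p * c.
  have yx : ip (A y) x = Num.conj p by rewrite positive_symmetric ipC.
  have := posA (x - (r%:C * p) *: y).
  rewrite lin_opB lin_opZ ipBl !ipBr !ipZl !ipZr yx -/p lecE => /andP[_] /=.
  congr (_ <= _); rewrite !(ReB, ReM, ImM, ReJ, ImJ) /= -/a -/c /sqnorm.
  have -> : Im (ip (A y) y) = 0 by exact: ger0_Im.
  ring.
have p0 := sqnorm_ge0 p.
have [c_gt0|] := ltP 0 c.
  have := key c^-1; rewrite -(pmulr_rge0 _ c_gt0).
  have -> : c * (a - 2 * c^-1 * sqnorm p + c^-1 ^+ 2 * sqnorm p * c) = a * c - sqnorm p.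
    by field; rewrite gt_eqF.
  by rewrite subr_ge0.
move=> cle0; have -> : c = 0 by apply/eqP; rewrite eq_le cle0.
rewrite mulr0 leNgt; apply/negP => p_gt0.
(* With [c = 0] the expression in [key] is affine in [r]; this [r] gives it the negative value
   [- a - 2]. *)
have := key ((a + 1) / sqnorm p).
have -> : c = 0 by apply/eqP; rewrite eq_le cle0.
by rewrite mulr0 addr0 -mulrA divfK ?gt_eqF// => h; lra.
Qed.

Lemma positive_eq0 x : Re (ip (A x) x) = 0 -> A x = 0.
Proof.
move=> qx; have := positive_CauchySchwarz x (A x).
rewrite qx mul0r => h; apply: hsq_eq0.
have : sqnorm (ip (A x) (A x)) = 0 by apply/eqP; rewrite eq_le h sqnorm_ge0.
by move=> /sqnorm_eq0 h'; rewrite /ip_sqnorm h'.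
Qed.
End Linear.

Lemma CauchySchwarz_hsq x y : sqnorm (ip x y) <= hsq x * hsq y.
Proof.
apply: (positive_CauchySchwarz (A := id)) => [//|z]; exact: dnorm_ge0.
Qed.

Lemma hsqD x y : hsq (x + y) = hsq x + hsq y + 2 * Re (ip x y).
Proof.
rewrite /ip_sqnorm ipDl !ipDr !ReD.
have -> : Re (ip y x) = Re (ip x y) by rewrite ipC ReJ.
ring.
Qed.

Lemma hsqB x y : hsq (x - y) = hsq x + hsq y - 2 * Re (ip x y).
Proof.
rewrite hsqD hsqN -[X in ip x X]scaleN1r ipZr ReM.
have -> : Num.conj (-1 : R[i]) = -1 by rewrite rmorphN rmorph1.
rewrite /= oppr0 mul0r; ring.
Qed.

Lemma hsqD_le x y : hsq (x + y) <= 2 * (hsq x + hsq y).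
Proof. by have := hsq_ge0 (x - y); rewrite hsqB hsqD; lra. Qed.

Lemma cvg_hsq T (F : set_system T) {FF : Filter F} (g : T -> H) x :
  g t @[t --> F] --> x <-> forall e : R, 0 < e -> \forall t \near F, hsq (x - g t) < e.
Proof.
have key y (e : R) : 0 <= e -> (`|y| < e%:C) = (hsq y < e ^+ 2).
  move=> e0; rewrite -ltcR hsq_norm rmorphXn/= ltr_pXn2r ?nnegrE//.
  by rewrite ler0c.
split.
  move=> /cvgrPdist_lt cv e e0.
  have := cv (Num.sqrt e)%:C; rewrite ltcR sqrtr_gt0 => /(_ e0).
  by apply: filterS => t; rewrite key ?sqrtr_ge0// sqr_sqrtr// ltW.
move=> cv; apply/cvgrPdist_lt => e e0.
have eE : e = (Re e)%:C by apply: ge0_realC; exact: ltW.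
have e'0 : 0 < Re e by rewrite -ltcR -eE.
have := cv (Re e ^+ 2); rewrite exprn_gt0// => /(_ isT).
by apply: filterS => t; rewrite -key ?(ltW e'0)// -eE.
Qed.

Lemma cauchy_hsq (s : H ^nat) :
  (forall e : R, 0 < e -> exists N, forall m n, (N <= m <= n)%N -> hsq (s n - s m) < e) ->
  cvgn s.
Proof.
move=> cs; apply: cauchy_cvg; apply: cauchy_exP => e e0.
have eE : e = (Re e)%:C by apply: ge0_realC; exact: ltW.
have e'0 : 0 < Re e by rewrite -ltcR -eE.
have [N hN] := cs (Re e ^+ 2) (exprn_gt0 _ e'0).
exists (s N), N => //= n /= Nn; rewrite -ball_normE /= distrC.
have := hN N n; rewrite leqnn Nn => /(_ isT).
rewrite -ltcR hsq_norm rmorphXn/= ltr_pXn2r ?nnegrE ?ler0c ?(ltW e'0)//.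
by rewrite -eE.
Qed.

Lemma cvg_ipl T (F : set_system T) {FF : Filter F} (g : T -> H) x y :
  g t @[t --> F] --> x ->
  Re (ip (g t) y) @[t --> F] --> Re (ip x y) /\
  Im (ip (g t) y) @[t --> F] --> Im (ip x y).
Proof.
move=> /cvg_hsq cv; split; apply/cvgrPdist_le => e e0.
all: have y0 := hsq_ge0 y; have ye : 0 < e ^+ 2 / (hsq y + 1) by
  rewrite divr_gt0 ?exprn_gt0//; lra.
all: have := cv _ ye; apply: filterS => t.
all: rewrite ltr_pdivlMr; last by lra.
all: move=> h; rewrite -(ler_pXn2r (n := 2)) ?nnegrE ?(ltW e0)// real_normK ?num_real//.
all: have := CauchySchwarz_hsq (x - g t) y; have := hsq_ge0 (x - g t).
  rewrite -ReB -ipBl /sqnorm; have := sqr_ge0 (Im (ip (x - g t) y)); nra.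
rewrite -ImN -ImD -ipBl /sqnorm; have := sqr_ge0 (Re (ip (x - g t) y)); nra.
Qed.

End InnerProduct.

(** * Orthonormal systems and traces *)

Section OrthonormalSystems.
Variables (R : realType) (H : completeNormedModType R[i]).
Variable ip : {dot H for Num.conj}.
Hypothesis ip_norm : norm_from_ip ip.
Implicit Types (x y u v : H) (A : H -> H).
Local Notation hsq := (ip_sqnorm ip).

Definition orthonormal_set (E : set H) :=
  forall u v, E u -> E v -> ip u v = (u == v)%:R.

(* The points of a countable dense set near distinct orthonormal vectors, which are
   at distance [sqrt 2], are distinct. *)
Lemma orthonormal_set_countable (E : set H) :
  separable_space H -> orthonormal_set E -> countable E.
Proof.
move=> [D cD dD] oE.
(* If [u] and [v] share such a point then |u - v|^2 < 2 (1/4 + 1/4) = 1, against the value 2 for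
   distinct orthonormal vectors. *)
have near u : exists d, D d /\ hsq (u - d) < 4^-1.
  have [||d [/= bd Dd]] := dD (ball u (2^-1 : R[i])).
  - by exists u; apply: ballxx; rewrite invr_gt0 ltr0n.
  - exact: ball_open.
  exists d; split => //; move: bd; rewrite -ball_normE /= => bd.
  have : `|u - d| ^+ 2 < (2^-1) ^+ 2 by rewrite ltr_pXn2r ?nnegrE.
  have -> : (2^-1 : R[i]) = (2^-1 : R)%:C by rewrite fmorphV rmorph_nat.
  rewrite -(hsq_norm ip_norm).
  by rewrite -rmorphXn ltcR => h; apply: lt_le_trans h _; lra.
have [d hd] := choice near.
have dinj : {in E &, injective d}.
  move=> u v /set_mem Eu /set_mem Ev duv; apply/eqP; apply: contraT => uv.
  have : hsq (u - v) < 1.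
    have -> : u - v = (u - d u) + (d u - v) by rewrite addrA subrK.
    apply: le_lt_trans (hsqD_le ip_norm _ _) _.
    have := (hd u).2; have := (hd v).2; rewrite -duv (hsqBC ip_norm (d u) v); lra.
  rewrite (hsqB ip_norm) /ip_sqnorm !oE// !eqxx (negPf uv) /=; lra.
have /countable_injP[g ginj] := cD.
apply/countable_injP; exists (g \o d) => u v Eu Ev /= /ginj h.
by apply: dinj => //; apply: h; apply/mem_set; have := hd u; have := hd v => -[? _] [? _].
Qed.

Lemma orthonormal_enum (E : set H) :
  separable_space H -> orthonormal_set E ->
  exists e : nat -> H, [/\ orthonormal_system ip e,
    forall n, e n = 0 \/ E (e n) & forall u, E u -> exists n, e n = u].
Proof.
move=> sH oE; have /countable_injP[g ginj] := orthonormal_set_countable sH oE.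
(* An index that codes no vector of [E] gets the default value 0, which [orthonormal_system]
   allows. *)
pose e n := xget 0 [set u | E u /\ g u = n].
have eE n : e n = 0 \/ E (e n) /\ g (e n) = n.
  by rewrite /e; case: xgetP => [u -> [Eu gu]|_]; [right|left].
exists e; split.
- split=> [i j ij|i].
    have [->|[Ei gi]] := eE i; first by rewrite ip0l.
    have [->|[Ej gj]] := eE j; first by rewrite ip0r.
    rewrite oE//; case: eqP => // eij; move: ij; by rewrite -gi -gj eij eqxx.
  have [->|[Ei gi]] := eE i; first by left.
  by right; rewrite oE// eqxx.
- by move=> n; have [|[]] := eE n; [left|right].
- move=> u Eu; exists (g u); rewrite /e; case: xgetP => [v _ [Ev gv]|/(_ u) []//].
  by apply: ginj => //; exact/mem_set.
Qed.

Section System.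
Variable e : nat -> H.
Hypothesis oe : orthonormal_system ip e.
Definition expansion x : H ^nat := series (fun i => ip x (e i) *: e i).

Lemma ip_system i j : ip (e i) (e j) = if i == j then (ip (e i) (e i)) else 0.
Proof. by case: eqP => [->//|/eqP]; exact: oe.1. Qed.

Lemma ip_system_scale i x : ip x (e i) * ip (e i) (e i) = ip x (e i).
Proof. by have [->|->] := oe.2 i; rewrite ?ip0r ?mul0r ?mulr1. Qed.

Lemma ip_expansion x n j : ip (expansion x n) (e j) = if (j < n)%N then ip x (e j) else 0.
Proof.
rewrite /expansion /series /= ip_suml; case: ltnP => jn.
  rewrite (bigD1_seq j) ?mem_index_iota ?iota_uniq//= ipZl ip_system_scale.
  rewrite big1 ?addr0// => i ij; rewrite ipZl ip_system (negPf ij) mulr0//.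
rewrite big_nat_cond big1// => i; rewrite andbT => ni.
rewrite ipZl ip_system; case: eqP => [ij|]; last by rewrite mulr0.
by move: ni; rewrite ij ltnNge jn.
Qed.

Lemma sqnorm_expansionB x m n : (m <= n)%N ->
  hsq (expansion x n - expansion x m) = \sum_(m <= i < n) sqnorm (ip x (e i)).
Proof.
move=> mn; rewrite /ip_sqnorm [X in ip _ X]sub_series_geq//.
rewrite ip_sumr Re_sum; apply: eq_big_nat => i /andP[mi ni].
rewrite ipZr ipBl !ip_expansion ni ltnNge mi /= subr0 mulrC mulC_conj//.
Qed.

Lemma sqnorm_residual x n :
  hsq (x - expansion x n) = hsq x - \sum_(0 <= i < n) sqnorm (ip x (e i)).
Proof.
have e0 : expansion x 0 = 0 by rewrite /expansion /series /= big_geq.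
rewrite -[expansion x n]subr0 -e0.
rewrite -sqnorm_expansionB// (hsqB ip_norm).
suff -> : Re (ip x (expansion x n - expansion x 0)) =
  hsq (expansion x n - expansion x 0) by ring.
rewrite sqnorm_expansionB// e0 subr0 /expansion.
rewrite /series /= ip_sumr Re_sum; apply: eq_big_nat => i _.
by rewrite ipZr mulrC mulC_conj.
Qed.

Lemma Bessel x n : \sum_(0 <= i < n) sqnorm (ip x (e i)) <= hsq x.
Proof. by rewrite -subr_ge0 -sqnorm_residual hsq_ge0. Qed.

Lemma expansion_cvg x : cvgn (expansion x).
Proof.
apply: (cauchy_hsq ip_norm) => d d0.
pose t := series (fun i => sqnorm (ip x (e i))).
have tnd : {homo t : n m / (n <= m)%N >-> n <= m}.
  by apply: nondecreasing_series => i _ _; exact: sqnorm_ge0.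
have : cvgn t.
  apply: nondecreasing_is_cvgn => //.
  by exists (hsq x) => _ [n _ <-]; exact: Bessel.
move=> ct; have /cvgrPdist_lt/(_ _ d0)[N _ hN] := ct.
exists N => m n /andP[Nm mn]; rewrite sqnorm_expansionB// -(sub_series_geq _ mn).
have := hN m Nm; have := tnd _ _ mn.
have : t n <= limn t by apply: nondecreasing_cvgn_le.
rewrite /= -/(t n) -/(t m) => h1 h2.
rewrite ger0_norm ?subr_ge0; lra.
Qed.

Hypothesis complete : forall x, (forall i, ip x (e i) = 0) -> x = 0.

(** Each coefficient of the partial sums is eventually that of [x], hence by continuity so is that
    of the limit; completeness identifies the limit with [x]. *)
Lemma expansion_cvg_to x : expansion x n @[n --> \oo] --> x.
Proof.
suff {2}-> : x = lim (expansion x n @[n --> \oo]) by exact: (@expansion_cvg x).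
apply/eqP; rewrite -subr_eq0; apply/eqP/complete => i.
have cv := @expansion_cvg x; rewrite ipBl.
have [cR cI] := cvg_ipl ip_norm (e i) cv.
set L := ip (lim _) _ in cR cI *.
suff -> : L = ip x (e i) by rewrite subrr.
have ev : \forall n \near \oo, ip (expansion x n) (e i) = ip x (e i).
  by exists i.+1 => // n /= i_n; rewrite ip_expansion i_n.
apply: complexP.
- apply: (cvg_unique (@Rhausdorff R) cR); apply: cvg_near_cst.
  by apply: filterS ev => n ->.
- apply: (cvg_unique (@Rhausdorff R) cI); apply: cvg_near_cst.
  by apply: filterS ev => n ->.
Qed.

Lemma Parseval x y :
  (\sum_(0 <= i < n) Re (ip x (e i) * ip (e i) y)) @[n --> \oo] --> Re (ip x y).
Proof.
have [h _] := cvg_ipl ip_norm y (@expansion_cvg_to x).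
suff -> : (fun n => \sum_(0 <= i < n) Re (ip x (e i) * ip (e i) y)) =
  (fun n => Re (ip (expansion x n) y)) by [].
apply/funext => n.
by rewrite /expansion /series /= ip_suml Re_sum; apply: eq_bigr => i _; rewrite ipZl.
Qed.

(** Being a value of the quadratic form, it is real and equals 0 at the null vectors of the system,
    so sums over all indices need no side condition. *)
Definition eigval A i := Re (ip (A (e i)) (e i)).
Definition diagonal_in A := forall i, A (e i) = (eigval A i)%:C *: e i.

Lemma eigval_ge0 A i : positive_op ip A -> 0 <= eigval A i.
Proof. by move=> pA; have := pA (e i); rewrite lecE => /andP[_]. Qed.

Lemma diagonal_inP A (g : nat -> R) :
  (forall i, A (e i) = (g i)%:C *: e i) -> diagonal_in A.
Proof.
move=> Ag i; rewrite /eigval Ag; have [->|ei] := oe.2 i; first by rewrite !scaler0.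
by rewrite ipZl ei mulr1.
Qed.

Lemma eigvalE A r i : e i <> 0 -> A (e i) = r%:C *: e i -> eigval A i = r.
Proof.
by move=> ei0 Ag; rewrite /eigval Ag ipZl; have [//|->] := oe.2 i; rewrite mulr1.
Qed.

Lemma diagonal_ip A x i : linear A -> positive_op ip A -> diagonal_in A ->
  ip (A x) (e i) = (eigval A i)%:C * ip x (e i).
Proof.
by move=> linA pA dA; rewrite (positive_symmetric linA pA) dA ipZr conj_realC.
Qed.

Lemma quadratic_diagonal A x : linear A -> positive_op ip A -> diagonal_in A ->
  (\sum_(0 <= i <oo) (eigval A i * sqnorm (ip x (e i)))%:E = (Re (ip (A x) x))%:E)%E.
Proof.
move=> linA pA dA; apply: cvg_lim => //.
have := @Parseval x (A x); rewrite -(positive_symmetric linA pA) => cv.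
rewrite [X in X @ _](_ : _ =
  EFin \o (fun n => \sum_(0 <= i < n) Re (ip x (e i) * ip (e i) (A x)))).
  by apply: cvg_EFin; [exact: nearW|exact: cv].
apply/funext => n /=; rewrite sumEFin; congr EFin; apply: eq_bigr => i _.
rewrite [ip (e i) _]ipC diagonal_ip// rmorphM/= conj_realC mulrCA ReZ.
by rewrite mulC_conj.
Qed.

Lemma nneseries_sqnorm x : (\sum_(0 <= i <oo) (sqnorm (ip x (e i)))%:E = (hsq x)%:E)%E.
Proof.
have pid : positive_op ip id by move=> z; exact: dnorm_ge0.
rewrite -(quadratic_diagonal (A := id))//; last first.
  by apply: (@diagonal_inP _ (fun=> 1)) => i; rewrite scale1r.
apply: eq_eseriesr => i _; congr EFin; rewrite /eigval.
have [->|->] := oe.2 i; last by rewrite mul1r.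
by rewrite !ip0r mul0r /sqnorm /= expr0n addr0.
Qed.
End System.

(** Turns the sum over a basis in [Tr] into a series; the condition [a 0 = 0] makes the null indices
    harmless. *)
Lemma orthonormal_basis_system (E : set H) :
  separable_space H -> orthonormal_basis ip E ->
  exists e : nat -> H, [/\ orthonormal_system ip e,
    forall x, (forall i, ip x (e i) = 0) -> x = 0,
    forall n, e n = 0 \/ E (e n) &
    forall a : H -> \bar R, (forall u, E u -> (0 <= a u)%E) -> a 0 = 0%E ->
      (\esum_(u in E) a u = \sum_(0 <= i <oo) a (e i))%E].
Proof.
move=> sH [oE cE]; have [e [oe eE eS]] := orthonormal_enum sH oE.
exists e; split => //.
  by move=> x xe; apply: cE => u /eS[n <-]; exact: xe.
move=> a a0 az.
have bij : set_bij [set n | e n <> 0] E e.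
  split.
  - by move=> n /= en; have [|//] := eE n.
  - move=> i j /set_mem/= ei /set_mem/= ej eij; apply/eqP; apply: contraT => ij.
    have := oe.1 _ _ ij; rewrite -eij; have [//|->] := oe.2 i.
    by move=> /eqP; rewrite oner_eq0.
  - move=> u Eu; have [n en] := eS _ Eu; exists n => //=; rewrite en => u0.
    by have := oE _ _ Eu Eu; rewrite u0 ip0l eqxx => /esym/eqP; rewrite oner_eq0.
rewrite (reindex_esum _ _ _ a bij) esum_mkcond nneseries_esumT.
  apply: eq_esum => i _; case: ifPn => //; rewrite notin_setE/= => /contrapT ->.
  by rewrite az.
by move=> n; have [->|En] := eE n; [rewrite az|exact: a0].
Qed.

(* [Tr] sums over [set0] when there is no orthonormal basis, so one operator with
   nonzero trace suffices for a basis to exist. *)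
Lemma Tr_system A : separable_space H -> Tr ip A <> 0%E -> linear A -> positive_op ip A ->
  exists d : nat -> H, [/\ orthonormal_system ip d,
    forall x, (forall i, ip x (d i) = 0) -> x = 0 &
    forall B, linear B -> positive_op ip B ->
      (Tr ip B = \sum_(0 <= i <oo) (Re (ip (B (d i)) (d i)))%:E)%E].
Proof.
move=> sH; rewrite /Tr; case: xgetP => [E _ oE|]; last by rewrite esum_set0.
move=> _ linA pA.
have [e [oe ce eE aE]] := orthonormal_basis_system sH oE.
exists e; split => // B linB pB; apply: aE; last by rewrite ip0r.
by move=> u Eu; rewrite lee_fin -lecR -ge0_realC.
Qed.

(** Basis independence of the trace: expand each [d j] in the eigenbasis [e], exchange the two sums
    of nonnegative terms, and apply Parseval to [e i] in [d]. *)
Lemma Tr_diagonal (d e : nat -> H) :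
  orthonormal_system ip d -> (forall x, (forall i, ip x (d i) = 0) -> x = 0) ->
  orthonormal_system ip e -> (forall x, (forall i, ip x (e i) = 0) -> x = 0) ->
  forall A, linear A -> positive_op ip A -> diagonal_in e A ->
  (\sum_(0 <= i <oo) (Re (ip (A (d i)) (d i)))%:E =
   \sum_(0 <= i <oo) (eigval e A i)%:E)%E.
Proof.
move=> od cd oe ce A linA pA dA.
transitivity (\sum_(0 <= j <oo) \sum_(0 <= i <oo)
    (eigval e A i * sqnorm (ip (d j) (e i)))%:E)%E.
  by apply: eq_eseriesr => j _; rewrite quadratic_diagonal.
rewrite nneseries_interchange => [|i j]; last first.
  by rewrite lee_fin mulr_ge0 ?sqnorm_ge0 ?eigval_ge0.
apply: eq_eseriesr => i _; under eq_eseriesr do rewrite EFinM sqnorm_ipC.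
rewrite nneseriesZl => [|j _]; last by rewrite lee_fin sqnorm_ge0.
rewrite nneseries_sqnorm// -EFinM; congr EFin.
rewrite /eigval /ip_sqnorm; have [->|->] := oe.2 i; last by rewrite mulr1.
by rewrite !ip0r mulr0.
Qed.

End OrthonormalSystems.

(** * Joint diagonalization *)

(** The segment is compact, and a cluster point of an ultrafilter is a limit of it. *)
Lemma ultra_bounded_cvg (R : realType) T (U : set_system T) (g : T -> R) (M : R) :
  UltraFilter U -> (forall t, `|g t| <= M) -> exists r : R, g t @[t --> U] --> r.
Proof.
move=> UU gM.
have [|r [_ cr]] := @segment_compact R (- M) M (g @ U) (fmap_proper_filter g _).
  suff : U (g @^-1` `[- M, M]%classic) by [].
  by apply: filterE => t; rewrite /= in_itv/= -ler_norml.
exists r => B nB; rewrite /= nbhs_filterE.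
have [//|UnB] := in_ultra_setVsetC (g @^-1` B) UU.
have : (g @ U) (~` B) by [].
by move=> /(cr _ _)/(_ nB)[? []].
Qed.

(** * Compactness and eigenvectors of positive trace-class operators *)

Section TraceClass.
Variables (R : realType) (H : completeNormedModType R[i]).
Variable ip : {dot H for Num.conj}.
Hypothesis ip_norm : norm_from_ip ip.
Implicit Types (x y u v : H) (A : H -> H).
Local Notation hsq := (ip_sqnorm ip).

Variable d : nat -> H.
Hypothesis od : orthonormal_system ip d.
Hypothesis cd : forall x, (forall i, ip x (d i) = 0) -> x = 0.

Section Operator.
Variable T : H -> H.
Hypotheses (linT : linear T) (posT : positive_op ip T).
Let q x := Re (ip (T x) x).
Hypothesis trT : (\sum_(0 <= i <oo) (q (d i))%:E < +oo)%E.
Let t := series (fun i => q (d i)).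
Let L := limn t.

Let q_ge0 x : 0 <= q x. Proof. by rewrite -lecR -ge0_realC. Qed.

Let t_cvg : cvgn t. Proof. by apply: nnseries_is_cvg. Qed.

Let t_nd : {homo t : n m / (n <= m)%N >-> n <= m}.
Proof. by apply: nondecreasing_series => i _ _; exact: q_ge0. Qed.

Let t_le n : t n <= L. Proof. exact: nondecreasing_cvgn_le. Qed.

Let L_ge0 : 0 <= L.
Proof. by apply: le_trans (t_le 0); rewrite /t /series /= big_geq. Qed.

(** Cauchy-Schwarz for the form of [T] bounds the squared coefficient at [d i] by [q x * q (d i)].
    The second factor is summable independently of [x], so tails are uniformly small on bounded
    sets. *)
Lemma sqnorm_tail x N : hsq (T x - expansion ip d (T x) N) <= q x * (L - t N).
Proof.
apply/ler_addgt0Pr => e e0.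
have /(cvg_hsq ip_norm)/(_ _ e0)[n0 _ hn0] :=
  @expansion_cvg_to _ _ _ ip_norm _ od cd (T x).
pose n := maxn n0 N.
have Nn : (N <= n)%N by rewrite leq_maxr.
have := hn0 n (leq_maxl _ _); rewrite /= !sqnorm_residual// => h.
have : \sum_(N <= i < n) sqnorm (ip (T x) (d i)) <= q x * (t n - t N).
  rewrite sub_series_geq// mulr_sumr; apply: ler_sum => i _.
  exact: positive_CauchySchwarz.
have := ler_wpM2l (q_ge0 x) (lerB (t_le n) (lexx (t N))).
move: h; rewrite [in X in X -> _](@big_cat_nat _ _ _ N)//=; lra.
Qed.

Lemma sqnorm_trace_class x : hsq (T x) <= q x * L.
Proof.
have := sqnorm_tail x 0; rewrite /expansion /t /series /= !big_geq// !subr0.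
by [].
Qed.

Lemma quadratic_trace_class x : q x <= L * hsq x.
Proof.
have [->|qx] := eqVneq (q x) 0; first by rewrite mulr_ge0 ?hsq_ge0.
have qx0 : 0 < q x by rewrite lt_neqAle eq_sym qx q_ge0.
rewrite -(ler_pM2l qx0) mulrA.
apply: (@le_trans _ _ (sqnorm (ip (T x) x))).
  by rewrite /sqnorm -expr2 lerDl sqr_ge0.
apply: le_trans (CauchySchwarz_hsq ip _ _) _.
by rewrite ler_wpM2r ?hsq_ge0// sqnorm_trace_class.
Qed.

(** Each coordinate is bounded, hence converges along [U], and so do finite partial sums; the tails
    are uniformly small by [sqnorm_tail]. An ultrafilter replaces the extraction of a diagonal
    subsequence. *)
Lemma compact_trace_class (U : set_system nat) (x : nat -> H) :
  UltraFilter U -> (forall n, hsq (x n) <= 1) -> cvg (T (x n) @[n --> U]).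
Proof.
move=> UU x1.
have qL n : q (x n) <= L.
  by apply: le_trans (quadratic_trace_class _) _; rewrite ler_piMr.
have d1 i : hsq (d i) <= 1.
  by rewrite /ip_sqnorm; have [->|->] := od.2 i; rewrite ?ip0r.
have bnd i n : sqnorm (ip (T (x n)) (d i)) <= L ^+ 2.
  apply: le_trans (CauchySchwarz_hsq ip _ _) _.
  apply: (@le_trans _ _ (hsq (T (x n)))); first by rewrite ler_piMr// hsq_ge0.
  by apply: le_trans (sqnorm_trace_class _) _; rewrite expr2 ler_wpM2r.
have bR i n : `|Re (ip (T (x n)) (d i))| <= L.
  rewrite -(ler_pXn2r (n := 2))// ?nnegrE// real_normK ?num_real//.
  by apply: le_trans (bnd i n); rewrite lerDl sqr_ge0.
have bI i n : `|Im (ip (T (x n)) (d i))| <= L.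
  rewrite -(ler_pXn2r (n := 2))// ?nnegrE// real_normK ?num_real//.
  by apply: le_trans (bnd i n); rewrite lerDr sqr_ge0.
have coord i : exists c : R[i], ip (T (x n)) (d i) *: d i @[n --> U] --> c *: d i.
  have [a /cvgrPdist_lt ca] := ultra_bounded_cvg UU (bR i).
  have [b /cvgrPdist_lt cb] := ultra_bounded_cvg UU (bI i).
  exists (a +i* b); apply/(cvg_hsq ip_norm) => e e0.
  have se : 0 < Num.sqrt (e / 2) by rewrite sqrtr_gt0; lra.
  near=> n; rewrite -scalerBl (hsqZ ip_norm).
  apply: (@le_lt_trans _ _ (sqnorm (a +i* b - ip (T (x n)) (d i)))).
    by rewrite ler_piMr ?sqnorm_ge0.
  have : `|a - Re (ip (T (x n)) (d i))| < Num.sqrt (e / 2) by near: n; exact: ca.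
  have : `|b - Im (ip (T (x n)) (d i))| < Num.sqrt (e / 2) by near: n; exact: cb.
  rewrite -ltr_sqr ?nnegrE// real_normK ?num_real// sqr_sqrtr; last lra.
  move=> h1.
  rewrite -ltr_sqr ?nnegrE// real_normK ?num_real// sqr_sqrtr; last lra.
  by move=> h2; rewrite /sqnorm ReB ImD ImN /=; lra.
have partial N : exists y, expansion ip d (T (x n)) N @[n --> U] --> y.
  elim: N => [|N [y cy]].
    exists 0; apply: cvg_near_cst; apply: filterE => n.
    by rewrite /expansion /series /= big_geq.
  have [c cc] := coord N; exists (y + c *: d N).
  rewrite (_ : (fun n => _) =
    fun n => expansion ip d (T (x n)) N + ip (T (x n)) (d N) *: d N).
    exact: cvgD.
  by apply/funext => n; rewrite /expansion seriesSr.
apply: cauchy_cvg; apply: cauchy_exP => e e0.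
have eE : e = (Re e)%:C by apply: ge0_realC; exact: ltW.
have e'0 : 0 < Re e by rewrite -ltcR -eE.
(* The head and the tail each contribute less than e^2 / 4, and [hsqD_le] doubles their sum; [L + 1]
   keeps the divisor positive. *)
have e4 : 0 < Re e ^+ 2 / 4 by rewrite divr_gt0// exprn_gt0.
have /cvgrPdist_lt/(_ (Re e ^+ 2 / 4 / (L + 1)))[|N _ hN] := t_cvg.
  by rewrite divr_gt0//; have := L_ge0; lra.
have [y cy] := partial N; exists y.
have /(cvg_hsq ip_norm)/(_ _ e4) := cy.
apply: filterS => n /= hn; rewrite -ball_normE /=.
suff : hsq (y - T (x n)) < Re e ^+ 2.
  rewrite -ltcR (hsq_norm ip_norm) rmorphXn/= ltr_pXn2r ?nnegrE ?ler0c ?(ltW e'0)//.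
  by rewrite -eE.
have -> : y - T (x n) =
    (y - expansion ip d (T (x n)) N) + (expansion ip d (T (x n)) N - T (x n)).
  by rewrite addrA subrK.
apply: le_lt_trans (hsqD_le ip_norm _ _) _.
have := sqnorm_tail (x n) N; rewrite (hsqBC ip_norm (T (x n))) => h.
have := hN N (leqnn N); rewrite /= -/L ger0_norm ?subr_ge0// ltr_pdivlMr; last first.
  by have := L_ge0; lra.
have LN : 0 <= L - t N by rewrite subr_ge0.
have := ler_wpM2r LN (qL n); have := L_ge0; move: h hn.
set a := hsq _; set b := hsq _; nra.
Unshelve. all: by end_near.
Qed.

(* The top eigenvalue of [T] on [W] is the supremum [M] of its quadratic form on the
   unit sphere of [W]: as [|T x - M x|^2 <= M (M - <T x, x>)] there, a maximizing
   sequence converges to an eigenvector along an ultrafilter, by compactness. *)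
Lemma exists_eigenvector (W : set H) :
  continuous T -> closed W ->
  (forall a x y, W x -> W y -> W (a *: x + y)) -> (forall x, W x -> W (T x)) ->
  (exists2 x, W x & x <> 0) ->
  exists z, [/\ W z, z <> 0 & exists r : R, T z = r%:C *: z].
Proof.
move=> ctsT clW linW TW [x0 Wx0 x0N].
have W0 : W 0 by have := linW (-1) x0 x0 Wx0 Wx0; rewrite scaleN1r addNr.
have WZ a x : W x -> W (a *: x) by move=> Wx; have := linW a x 0 Wx W0; rewrite addr0.
have hsq_gt0 x : x <> 0 -> 0 < hsq x.
  move=> xN; rewrite lt_neqAle hsq_ge0 andbT eq_sym; apply/eqP.
  by move/(hsq_eq0).
have qZ a x : q (a *: x) = sqnorm a * q x.
  by rewrite /q lin_opZ// ipZl ipZr mulrA mulC_conj ReZ.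
have normalize x : x <> 0 -> hsq ((Num.sqrt (hsq x))^-1%:C *: x) = 1.
  move=> /hsq_gt0 xN; rewrite (hsqZ ip_norm) sqnorm_real exprVn sqr_sqrtr ?hsq_ge0//.
  by rewrite mulVf// gt_eqF.
pose E := [set q x | x in [set x | W x /\ hsq x = 1]].
have supE : has_sup E.
  split.
    exists (q ((Num.sqrt (hsq x0))^-1%:C *: x0)), ((Num.sqrt (hsq x0))^-1%:C *: x0) => //.
    by split; [exact: WZ|exact: normalize].
  exists L => _ [x [_ x1] <-]; apply: le_trans (quadratic_trace_class x) _.
  by rewrite x1 mulr1.
pose M := sup E.
have qM x : W x -> q x <= M * hsq x.
  move=> Wx; have [->|/eqP xN] := eqVneq x 0.
    by rewrite /q /ip_sqnorm lin_op0// ip0r mulr0.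
  have : E (q ((Num.sqrt (hsq x))^-1%:C *: x)).
    exists ((Num.sqrt (hsq x))^-1%:C *: x) => //.
    by split; [exact: WZ|exact: normalize].
  move=> /(sup_upper_bound supE); rewrite -/M qZ sqnorm_real exprVn sqr_sqrtr ?hsq_ge0//.
  by rewrite mulrC ler_pdivrMr// hsq_gt0.
(* If [M <= 0] the form vanishes at [x0], which is then an eigenvector for 0. *)
have [M0|M_gt0] := leP M 0.
  exists x0; split => //; exists 0; rewrite scale0r; apply: (positive_eq0 linT posT).
  apply/eqP; rewrite eq_le q_ge0 andbT; apply: le_trans (qM _ Wx0) _.
  by rewrite mulr_le0_ge0// hsq_ge0.
have approx n : exists x, [/\ W x, hsq x = 1 & M - n.+1%:R^-1 < q x].
  have n0 : 0 < n.+1%:R^-1 :> R by rewrite invr_gt0 ltr0n.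
  by have [_ [x [Wx x1] <-]] := sup_adherent n0 supE; exists x.
have [x xP] := choice approx.
have [U [UU subU]] := ultraFilterLemma (eventually_filter).
have x1 n : hsq (x n) <= 1 by have [_ ->] := xP n.
have cT := compact_trace_class UU x1.
set y := lim (T (x n) @[n --> U]) in cT *.
have defect n : hsq (M%:C *: x n - T (x n)) <= M * n.+1%:R^-1.
  have [Wx xn1 qx] := xP n.
  (* Cauchy-Schwarz for the form gives |T x|^4 <= q(x) q(T x), and q(T x) <= M |T x|^2 because [T x]
     stays in [W]. *)
  have TxM : hsq (T (x n)) <= M * q (x n).
    have [->|/eqP TxN] := eqVneq (T (x n)) 0.
      by rewrite /ip_sqnorm ip0r mulr_ge0 ?q_ge0 ?ltW.
    rewrite -(ler_pM2l (hsq_gt0 _ TxN)).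
    apply: (@le_trans _ _ (sqnorm (ip (T (x n)) (T (x n))))).
      by rewrite /sqnorm -expr2 lerDl sqr_ge0.
    apply: le_trans (positive_CauchySchwarz linT posT _ _) _.
    rewrite -/(q (x n)) -/(q (T (x n))) mulrC [leRHS]mulrA.
    by rewrite ler_wpM2r// mulrC; apply: qM; exact: TW.
  rewrite (hsqB ip_norm) (hsqZ ip_norm) sqnorm_real xn1 ipZl ReZ.
  rewrite [ip (x n) _]ipC ReJ -/(q (x n)).
  have := ltW M_gt0; set k := _^-1 in qx *; nra.
have cMx : M%:C *: x n @[n --> U] --> y.
  rewrite -[y]add0r.
  rewrite (_ : (fun n => _) = fun n => (M%:C *: x n - T (x n)) + T (x n)); last first.
    by apply/funext => n; rewrite subrK.
  apply: cvgD => //; apply/(cvg_hsq ip_norm) => e e0; apply: subU.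
  have Me : 0 < M / e by exact: divr_gt0.
  exists (Num.trunc (M / e)) => // n /= hn; rewrite sub0r (hsqN ip_norm).
  apply: le_lt_trans (defect n) _.
  rewrite ltr_pdivrMr ?ltr0n// mulrC -ltr_pdivrMr//.
  apply: (@lt_le_trans _ _ ((Num.trunc (M / e)).+1%:R)); last by rewrite ler_nat ltnS.
  by rewrite truncnS_gt.
pose z := (M^-1)%:C *: y.
have yz : y = M%:C *: z by rewrite /z scalerA -rmorphM/= mulfV ?gt_eqF// scale1r.
have cx : x n @[n --> U] --> z.
  rewrite (_ : x = fun n => (M^-1)%:C *: (M%:C *: x n)).
    exact: cvgZl_tmp.
  by apply/funext => n; rewrite scalerA -rmorphM/= mulVf ?gt_eqF// scale1r.
exists z; split.
- by apply: (closed_cvg W clW _ _ cx); apply: filterE => n; have [] := xP n.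
- move=> z0; have /(cvg_hsq ip_norm)/(_ _ ltr01) := cx; rewrite z0 => h.
  have [n] := filter_ex h; rewrite sub0r (hsqN ip_norm).
  by have [_ ->] := xP n; rewrite ltxx.
exists M; rewrite -yz; apply: (cvg_unique (@norm_hausdorff _ H) _ cT).
by apply: cvg_comp cx _; exact: ctsT.
Qed.

End Operator.
End TraceClass.

Section JointDiagonalization.
Variables (R : realType) (H : completeNormedModType R[i]).
Variable ip : {dot H for Num.conj}.
Hypothesis ip_norm : norm_from_ip ip.
Implicit Types (x y u v : H) (A B : H -> H).
Local Notation hsq := (ip_sqnorm ip).

Lemma closed_orthogonal u : closed [set x | ip x u = 0].
Proof.
have -> : [set x | ip x u = 0] =
    (fun x => Re (ip x u)) @^-1` [set 0] `&` (fun x => Im (ip x u)) @^-1` [set 0].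
  apply/seteqP; split=> x /=; first by move=> ->.
  by move=> [h1 h2]; exact: complexP.
apply: closedI; apply: closed_comp => [x _|]; try exact: closed_eq.
  by have [] := @cvg_ipl _ _ _ ip_norm _ (nbhs x) _ id x u cvg_id.
by have [] := @cvg_ipl _ _ _ ip_norm _ (nbhs x) _ id x u cvg_id.
Qed.

Lemma closed_eigenspace A (r : R) : continuous A -> closed [set x | A x = r%:C *: x].
Proof.
move=> cA; have -> : [set x | A x = r%:C *: x] = (fun x => A x - r%:C *: x) @^-1` [set 0].
  apply/seteqP; split=> x /=; first by move=> ->; rewrite subrr.
  by move/eqP; rewrite subr_eq0 => /eqP.
apply: closed_comp => [x _|].
  by apply: cvgB; [exact: cA|apply: cvgZl_tmp].
by apply: accessible_closed_set1; apply: hausdorff_accessible; exact: norm_hausdorff.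
Qed.

(** Zorn's lemma gives a maximal orthonormal set of joint eigenvectors. Its orthogonal complement
    [W] is invariant under [A] and [B]; if [W] were nonzero, an eigenspace of [A] in [W] would be
    nonzero, [B]-invariant by commutation, and contain an eigenvector of [B], against maximality. *)
Lemma joint_eigenbasis (d : nat -> H) A B :
  orthonormal_system ip d -> (forall x, (forall i, ip x (d i) = 0) -> x = 0) ->
  bounded_op A -> positive_op ip A ->
  (\sum_(0 <= i <oo) (Re (ip (A (d i)) (d i)))%:E < +oo)%E ->
  bounded_op B -> positive_op ip B ->
  (\sum_(0 <= i <oo) (Re (ip (B (d i)) (d i)))%:E < +oo)%E ->
  A \o B = B \o A ->
  exists E, orthonormal_basis ip E /\ forall u, E u ->
    (exists r : R, A u = r%:C *: u) /\ (exists r : R, B u = r%:C *: u).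
Proof.
move=> od cd [linA cA] pA trA [linB cB] pB trB AB.
pose P X := orthonormal_set ip X /\ forall u, X u ->
    (exists r : R, A u = r%:C *: u) /\ (exists r : R, B u = r%:C *: u).
have [F FP Ftot|E [[oE eE] maxE]] := @Zorn_bigcup _ P.
  split=> [u v [X FX Xu] [Y FY Yv]|u [X FX Xu]]; last by have [_] := FP _ FX; apply.
  have [XY|YX] := Ftot _ _ FX FY.
    by have [oY _] := FP _ FY; apply: oY => //; exact: XY.
  by have [oX _] := FP _ FX; apply: oX => //; exact: YX.
exists E; split => //; split => // x xE; apply: contrapT => xN.
pose W := [set y | forall u, E u -> ip y u = 0].
have clW : closed W.
  have -> : W = \bigcap_(u in E) [set y | ip y u = 0] by [].
  by apply: closed_bigI => u _; exact: closed_orthogonal.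
have linW a y z : W y -> W z -> W (a *: y + z).
  by move=> Wy Wz u Eu; rewrite ipDl ipZl Wy// Wz// mulr0 addr0.
have inv T : linear T -> positive_op ip T ->
    (forall u, E u -> exists r : R, T u = r%:C *: u) -> forall y, W y -> W (T y).
  move=> linT pT eT y Wy u Eu; rewrite (positive_symmetric linT pT).
  by have [r ->] := eT _ Eu; rewrite ipZr Wy// mulr0.
have WA := inv A linA pA (fun u Eu => (eE u Eu).1).
have WB := inv B linB pB (fun u Eu => (eE u Eu).2).
have Wx : exists2 y, W y & y <> 0 by exists x.
have [z [Wz zN [r Az]]] :=
  exists_eigenvector ip_norm od cd linA pA trA cA clW linW WA Wx.
pose W1 := W `&` [set y | A y = r%:C *: y].
have clW1 : closed W1 by apply: closedI => //; exact: closed_eigenspace.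
have linW1 a y y' : W1 y -> W1 y' -> W1 (a *: y + y').
  move=> [Wy /= Ay] [Wy' /= Ay']; split; first exact: linW.
  by rewrite /= linA Ay Ay' scalerDr !scalerA mulrC.
have W1B y : W1 y -> W1 (B y).
  move=> [Wy /= Ay]; split; first exact: WB.
  have /(congr1 (@^~ y)) /= -> := AB.
  by rewrite Ay (lin_opZ linB).
have W1z : exists2 z, W1 z & z <> 0 by exists z.
have [w [[Ww /= Aw] wN [s Bw]]] :=
  exists_eigenvector ip_norm od cd linB pB trB cB clW1 linW1 W1B W1z.
have hw : 0 < hsq w.
  by rewrite lt_neqAle hsq_ge0 andbT eq_sym; apply/eqP => /hsq_eq0.
pose w' := (Num.sqrt (hsq w))^-1%:C *: w.
have w1 : ip w' w' = 1.
  rewrite -hsqE (hsqZ ip_norm) sqnorm_real exprVn sqr_sqrtr ?hsq_ge0//.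
  by rewrite mulVf// gt_eqF.
have Ww' u : E u -> ip w' u = 0 by move=> Eu; rewrite ipZl Ww// mulr0.
have Ew' : ~ E w' by move=> /Ww'; rewrite w1 => /eqP; rewrite oner_eq0.
apply: (maxE (E `|` [set w'])).
  split; first by move=> u; left.
  by move=> /(_ w') h; apply: Ew'; apply: h; right.
split=> [u v|u].
  move=> [Eu|/= ->] [Ev|/= ->]; first exact: oE.
  - rewrite ipC Ww'// conjC0; case: eqP => // uw.
    by rewrite uw in Eu.
  - rewrite Ww'//; case: eqP => // uw.
    by rewrite -uw in Ev.
  - by rewrite w1 eqxx.
move=> [Eu|/= ->]; first exact: eE.
split; [exists r|exists s].
  by rewrite /w' (lin_opZ linA) Aw !scalerA mulrC.
by rewrite /w' (lin_opZ linB) Bw !scalerA mulrC.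
Qed.

(** * Functional calculus and absolute value of diagonal operators *)

Section DiagonalOperators.
Variable e : nat -> H.
Hypothesis oe : orthonormal_system ip e.
Hypothesis ce : forall x, (forall i, ip x (e i) = 0) -> x = 0.

Lemma spectral_rep_diagonal A : linear A -> positive_op ip A -> diagonal_in ip e A ->
  spectral_rep ip A (eigval ip e A, e).
Proof.
move=> linA pA dA; split => // x.
have := @expansion_cvg_to _ _ _ ip_norm _ oe ce (A x).
suff -> : diag_series ip (eigval ip e A) e x = expansion ip e (A x) by [].
rewrite /diag_series /expansion; congr series; apply/funext => i.
by rewrite diagonal_ip.
Qed.

Lemma eq_diagonal A B : linear A -> positive_op ip A -> diagonal_in ip e A ->
  linear B -> positive_op ip B -> diagonal_in ip e B ->
  eigval ip e A =1 eigval ip e B -> A = B.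
Proof.
move=> linA pA dA linB pB dB AB; apply/funext => x; apply/eqP.
rewrite -subr_eq0; apply/eqP/ce => i.
by rewrite ipBl !diagonal_ip// AB subrr.
Qed.

Lemma commute_diagonal A B : linear A -> positive_op ip A -> diagonal_in ip e A ->
  linear B -> positive_op ip B -> diagonal_in ip e B -> A \o B = B \o A.
Proof.
move=> linA pA dA linB pB dB; apply/funext => x /=; apply/eqP.
rewrite -subr_eq0; apply/eqP/ce => i.
by rewrite ipBl !diagonal_ip// mulrCA subrr.
Qed.

(** [fun_op] selects an arbitrary spectral representation, which exists as [A] is diagonal in [e].
    In any of them [u] is orthogonal to every [phi i] with [lam i <> r], so the series for [h(A) u]
    is [h r / r] times that for [A u]. *)
Lemma fun_op_eigenvector (h : R -> R) A u (r : R) :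
  (forall t : R, 0 <= t -> 0 <= h t <= t) ->
  linear A -> positive_op ip A -> diagonal_in ip e A -> A u = r%:C *: u ->
  fun_op ip h A u = (h r)%:C *: u.
Proof.
move=> hh linA pA dA Au; rewrite /fun_op; set s := xget _ _.
have [os cs] : spectral_rep ip A s.
  apply: (xgetPex (T := ((nat -> R) * (nat -> H))%type) (fun=> 0, fun=> 0)).
  by exists (eigval ip e A, e); exact: spectral_rep_diagonal.
set lam := s.1 in cs *; set phi := s.2 in os cs *.
have Aphi i : A (phi i) = (lam i)%:C *: phi i.
  apply: (cvg_unique (@norm_hausdorff _ H) (cs (phi i))).
  apply: cvg_near_cst; exists i.+1 => // n /= i_n.
  rewrite /diag_series /series /= (bigD1_seq i) ?mem_index_iota ?iota_uniq//=.
  rewrite big1 => [|j ji]; last first.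
    by rewrite (os.1 i j) ?mulr0 ?scale0r// eq_sym.
  rewrite addr0; have [->|->] := os.2 i; last by rewrite mulr1.
  by rewrite !scaler0.
have coef i : ip u (phi i) = 0 \/ lam i = r.
  have [|ui] := eqVneq (ip u (phi i)) 0; first by left.
  right; have : ip (A u) (phi i) = ip u (A (phi i)) by exact: positive_symmetric.
  rewrite Au Aphi ipZl ipZr conj_realC => /(mulIf ui) rl.
  exact/esym/(@complexI R).
have h0 : h 0 = 0.
  by apply/eqP; rewrite eq_le; have /andP[-> ->] := hh 0 (lexx 0).
(* For [r = 0] the quotient is 0 by convention, in agreement with [h 0 = 0]. *)
have hr : (h r / r)%:C *: A u = (h r)%:C *: u.
  rewrite Au scalerA -rmorphM/=.
  by have [->|r0] := eqVneq r 0; rewrite ?mulr0 ?h0// divfK.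
rewrite -hr /diag_op.
suff -> : diag_series ip (h \o lam) phi u =
    fun n => (h r / r)%:C *: diag_series ip lam phi u n.
  by apply: cvg_lim; [exact: norm_hausdorff|apply: cvgZl_tmp; exact: cs].
apply/funext => n; rewrite /diag_series /series /= scaler_sumr.
apply: eq_bigr => i _; rewrite scalerA; congr (_ *: _).
have [->|->] := coef i; first by rewrite !mulr0.
rewrite mulrA -rmorphM/=; congr (_%:C * _).
by have [->|r0] := eqVneq r 0; rewrite ?mulr0 ?h0// divfK.
Qed.

Section AbsoluteValue.
Variables (A : H -> H) (c : nat -> R).
Hypothesis symA : forall x y, ip (A x) y = ip x (A y).
Hypothesis eigA : forall i, A (e i) = (c i)%:C *: e i.

(** Uniqueness of the positive square root on one eigenvector: as [B^2 e_i = c_i^2 e_i], the vector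
    [v = B e_i - |c_i| e_i] satisfies [B v = - |c_i| v], and positivity of [B] forces [v = 0] when
    [c_i <> 0]. *)
Lemma is_abs_op_eigenvector B i : is_abs_op ip A B -> B (e i) = `|c i|%:C *: e i.
Proof.
move=> [[linB _] pB [A' adj /(congr1 (@^~ (e i))) /= BB]].
have {}BB : B (B (e i)) = (c i ^+ 2)%:C *: e i.
  rewrite BB; apply/eqP; rewrite -subr_eq0; apply/eqP/ce => j.
  rewrite ipC ipBr -adj !eigA !(ipZr, ipZl) !conj_realC.
  have [->|ij] := eqVneq i j; last by rewrite (oe.1 j i) 1?eq_sym// !mulr0 subrr conjC0.
  by rewrite mulrA -rmorphM/= -expr2 subrr conjC0.
set v := B (e i) - `|c i|%:C *: e i.
apply/eqP; rewrite -subr_eq0 -/v; apply/eqP.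
have Bv : B v = - (`|c i|%:C *: v).
  rewrite /v (lin_opB linB) (lin_opZ linB) BB scalerBr opprB scalerA -rmorphM/=.
  by rewrite -expr2 real_normK ?num_real.
have [c0|c0] := eqVneq (c i) 0.
  move: BB; rewrite c0 expr0n /= scale0r /v c0 normr0 scale0r subr0 => BB.
  apply: (@hsq_eq0 _ _ ip); rewrite /ip_sqnorm -(positive_symmetric linB pB) BB ip0l.
  by [].
apply: (@hsq_eq0 _ _ ip); apply/eqP; rewrite eq_le hsq_ge0 andbT.
have := pB v; rewrite Bv -scaleNr ipZl -hsqE -rmorphN -rmorphM ler0c.
by rewrite mulNr oppr_ge0 pmulr_rle0// normr_gt0.
Qed.

(* Without an absolute value, [abs_op ip A] would be the default value 0, and both
   [A / 2] and [- A / 2] would be positive. *)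
Lemma abs_op_is_abs : A <> 0 -> positive_op ip (pos_part ip A) ->
  positive_op ip (neg_part ip A) -> is_abs_op ip A (abs_op ip A).
Proof.
rewrite /pos_part /neg_part /abs_op; case: xgetP => [B -> //|_ AN ppos pneg].
exfalso; apply: AN; apply/funext => x; apply: ce => i.
rewrite symA eigA ipZr; have [->|ei] := oe.2 i; first by rewrite ip0r mulr0.
have half : 2^-1 = (2^-1)%:C :> R[i] by rewrite fmorphV rmorph_nat.
have E1 : (2^-1 *: ((0 : H -> H) + A)) (e i) = (2^-1 * c i)%:C *: e i.
  transitivity ((2^-1 : R[i]) *: (0 + A (e i))); first by [].
  by rewrite add0r eigA scalerA half -rmorphM.
have E2 : (2^-1 *: ((0 : H -> H) - A)) (e i) = (- (2^-1 * c i))%:C *: e i.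
  transitivity ((2^-1 : R[i]) *: (0 - A (e i))); first by [].
  by rewrite sub0r eigA scalerN scalerA half -rmorphM -scaleNr -rmorphN.
have := ppos (e i); have := pneg (e i); rewrite E1 E2 !ipZl ei !mulr1 !ler0c.
move=> h1 h2; have -> : c i = 0 by lra.
by rewrite conj_realC mul0r.
Qed.

Lemma pos_part_eigenvector i : is_abs_op ip A (abs_op ip A) ->
  pos_part ip A (e i) = (Num.max (c i) 0)%:C *: e i.
Proof.
move=> /is_abs_op_eigenvector absE.
have half : 2^-1 = (2^-1)%:C :> R[i] by rewrite fmorphV rmorph_nat.
transitivity ((2^-1 : R[i]) *: (abs_op ip A (e i) + A (e i))); first by [].
rewrite absE eigA -scalerDl scalerA half -rmorphD -rmorphM; congr (_%:C *: _).
by have [h|h] := leP (c i) 0; [rewrite ler0_norm//|rewrite gtr0_norm//]; lra.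
Qed.

Lemma neg_part_eigenvector i : is_abs_op ip A (abs_op ip A) ->
  neg_part ip A (e i) = (Num.max (- c i) 0)%:C *: e i.
Proof.
move=> /is_abs_op_eigenvector absE.
have half : 2^-1 = (2^-1)%:C :> R[i] by rewrite fmorphV rmorph_nat.
transitivity ((2^-1 : R[i]) *: (abs_op ip A (e i) - A (e i))); first by [].
rewrite absE eigA -scalerBl scalerA half -rmorphB -rmorphM; congr (_%:C *: _).
by have [h|h] := leP (- c i) 0; [rewrite ger0_norm//|rewrite ltr0_norm//]; lra.
Qed.
End AbsoluteValue.
End DiagonalOperators.
End JointDiagonalization.

(** * Almost affine functions on the cone *)

Section ModulusTheory.
Variables (R : realType) (a : R -> R).
Hypothesis a_mod : modulus a.

Lemma modulus_sym p : 0 <= p <= 1 -> a p = a (1 - p).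
Proof. by have [_ _ + _ _] := a_mod => h p01; apply: h; rewrite in_itv. Qed.

Lemma modulus_le x y : 0 <= x -> x <= y -> y <= 2^-1 -> a x <= a y.
Proof.
have [_ _ _ _ h] := a_mod => x0 xy y2.
by apply: h => //; rewrite in_itv /=; apply/andP; split; lra.
Qed.

Lemma modulus_scale t x : 0 <= t <= 1 -> 0 <= x <= 2^-1 -> t * a x <= a (t * x).
Proof.
move=> t01 x02; have [_ a0 _ cc _] := a_mod.
have := cc x 0; rewrite !in_itv/= x02 lexx invr_ge0 ler0n => /(_ isT isT t t01).
by rewrite a0 !mulr0 !addr0.
Qed.

Lemma modulus_ge0 p : 0 <= p <= 1 -> 0 <= a p.
Proof.
have [_ a0 _ _ _] := a_mod.
have low x : 0 <= x <= 2^-1 -> 0 <= a x.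
  by move=> /andP[x0 x2]; rewrite -a0; exact: modulus_le.
move=> p01; have [p2|p2] := leP p 2^-1; first by apply: low; lra.
by rewrite modulus_sym//; apply: low; lra.
Qed.

Lemma modulus_le_half p : 0 <= p <= 1 -> a p <= a 2^-1.
Proof.
move=> p01; have [p2|p2] := leP p 2^-1; first by apply: modulus_le => //; lra.
by rewrite modulus_sym//; apply: modulus_le => //; lra.
Qed.

Lemma flat_ext_ge0 eps : 0 <= eps -> 0 <= flat_ext a eps.
Proof. by move=> e0; rewrite /flat_ext; case: ifPn => e2; apply: modulus_ge0; lra. Qed.

(** For [eps <= 1/2], concavity and [a 0 = 0] give [r a(d/r) <= a(d)] if [d/r <= 1/2]; otherwise
    [r a(d/r) <= r a(1/2) <= a(r/2)] with [r/2 < d]. *)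
Lemma modulus_perspective_le_flat_ext d r eps :
  0 <= d -> d <= r -> 0 < r -> r <= 1 -> d <= eps -> r * a (d / r) <= flat_ext a eps.
Proof.
move=> d0 dr r0 r1 deps.
have p01 : 0 <= d / r <= 1 by rewrite divr_ge0 ?(ltW r0)//= ler_pdivrMr// mul1r.
have r01 : 0 <= r <= 1 by rewrite (ltW r0).
rewrite /flat_ext; case: ifPn => [e2|_]; last first.
  apply: le_trans (modulus_le_half p01).
  by rewrite ler_piMl// modulus_ge0.
have [p2|p2] := leP (d / r) 2^-1.
  apply: le_trans (modulus_scale r01 _) _; first by lra.
  by rewrite mulrC divfK ?gt_eqF//; apply: modulus_le.
apply: (@le_trans _ _ (r * a 2^-1)); first by rewrite ler_pM2l// modulus_le_half.
apply: le_trans (modulus_scale r01 _) _; first by lra.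
have : r / 2 < d by move: p2; rewrite ltr_pdivlMr// mulrC.
by move=> h; apply: modulus_le => //; lra.
Qed.
End ModulusTheory.

(** Monotonicity of D_f: on [0, 1] the ratio x / (1 + x) increases and stays in [0, 1/2], where the
    moduli are non-decreasing. *)
Lemma Dfun_ge (R : realType) (a b : R -> R) d eps : modulus a -> modulus b ->
  0 <= d -> d <= eps -> eps <= 1 ->
  (1 + d) * (a (d / (1 + d)) + b (d / (1 + d))) <= Dfun a b eps.
Proof.
move=> ma mb d0 de e1; rewrite /Dfun /=.
have half (x : R) : 0 <= x -> x <= 1 -> 0 <= x / (1 + x) <= 2^-1.
  move=> x0 x1; rewrite divr_ge0//=; last by lra.
  by rewrite ler_pdivrMr; lra.
have h1 := half d d0 (le_trans de e1); have h2 := half eps (le_trans d0 de) e1.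
have h3 : d / (1 + d) <= eps / (1 + eps).
  have d1 : 0 < 1 + d by lra.
  have e1' : 0 < 1 + eps by lra.
  rewrite (ler_pdivrMr _ _ d1) [leRHS]mulrAC (ler_pdivlMr _ _ e1') !mulrDr !mulr1.
  by rewrite [d * eps]mulrC lerD2r.
have := modulus_le ma; have := modulus_le mb => lb la.
have la1 := la _ _ (proj1 (andP h1)) h3 (proj2 (andP h2)).
have lb1 := lb _ _ (proj1 (andP h1)) h3 (proj2 (andP h2)).
have a0 : 0 <= a (eps / (1 + eps)) by apply: modulus_ge0 => //; lra.
have b0 : 0 <= b (eps / (1 + eps)) by apply: modulus_ge0 => //; lra.
have a1 : 0 <= a (d / (1 + d)) by apply: modulus_ge0 => //; lra.
have b1 : 0 <= b (d / (1 + d)) by apply: modulus_ge0 => //; lra.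
by apply: ler_pM; lra.
Qed.

Lemma Dfun_ge0 (R : realType) (a b : R -> R) eps : modulus a -> modulus b ->
  0 <= eps -> eps <= 1 -> 0 <= Dfun a b eps.
Proof.
move=> ma mb e0 e1; have := Dfun_ge ma mb (lexx 0) e0 e1.
have [_ a0 _ _ _] := ma; have [_ b0 _ _ _] := mb.
by rewrite mul0r a0 b0 !addr0 mulr0.
Qed.

(** * The cone generated by a convex set of states *)

Section StateCone.
Variables (R : realType) (H : completeNormedModType R[i]).
Variable ip : {dot H for Num.conj}.
Hypothesis ip_norm : norm_from_ip ip.
Variable d : nat -> H.
Hypothesis TrE : forall B, linear B -> positive_op ip B ->
  (Tr ip B = \sum_(0 <= i <oo) (Re (ip (B (d i)) (d i)))%:E)%E.
Variable S0 : set (H -> H).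
Hypothesis S0_states : forall rho, S0 rho -> is_state ip rho.
Hypothesis S0_convex : convex_set S0.
Implicit Types (A B tau : H -> H).

Lemma mix_S0 p A B : 0 <= p <= 1 -> S0 A -> S0 B -> S0 (mix p A B).
Proof.
move=> /andP[p0 p1] SA SB.
have p0' : 0 <= p%:C :> R[i] by rewrite ler0c.
have p1' : p%:C <= 1 :> R[i] by rewrite -[1]/(1%:C) lecR.
have := @S0_convex A B (Itv01 p0' p1') (mem_set SA) (mem_set SB).
move=> /set_mem; have -> : mix p A B = p%:C *: A + (1 - p%:C) *: B.
  by rewrite /mix rmorphB.
exact.
Qed.

Lemma linear_comb x y A B : linear A -> linear B -> linear (x *: A + y *: B).
Proof.
move=> lA lB k u v.
transitivity (x *: A (k *: u + v) + y *: B (k *: u + v)); first by [].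
rewrite lA lB !scalerDr !scalerA addrACA ![_ * k]mulrC -!scalerA.
by rewrite -scalerDr.
Qed.

Lemma linear_scale x A : linear A -> linear (x *: A).
Proof.
move=> lA k u v; transitivity (x *: A (k *: u + v)); first by [].
by rewrite lA scalerDr !scalerA mulrC -scalerA.
Qed.

Lemma positive_scale (x : R) A : 0 <= x -> positive_op ip A -> positive_op ip (x%:C *: A).
Proof.
move=> x0 pA u; rewrite (_ : ip _ u = x%:C * ip (A u) u); last exact: ipZl.
by rewrite mulr_ge0// ler0c.
Qed.

Lemma positive_add A B : positive_op ip A -> positive_op ip B -> positive_op ip (A + B).
Proof.
move=> pA pB u; rewrite (_ : ip _ u = ip (A u) u + ip (B u) u); last exact: ipDl.
by rewrite addr_ge0.
Qed.

Lemma cone_linear A : cone S0 A -> linear A.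
Proof. by move=> [c [tau [_ /S0_states[[lt _] _ _] ->]]]; exact: linear_scale. Qed.

Lemma cone_positive A : cone S0 A -> positive_op ip A.
Proof. by move=> [c [tau [c0 /S0_states[_ pt _] ->]]]; exact: positive_scale. Qed.

Lemma Tr_scale_state c tau : 0 <= c -> S0 tau -> Tr ip (c%:C *: tau) = c%:E.
Proof.
move=> c0 /S0_states[[lt _] pt trt].
rewrite TrE; [|exact: linear_scale|exact: positive_scale].
rewrite -[RHS]mule1 -trt TrE// -nneseriesZl => [|i _]; last first.
  by rewrite lee_fin -lecR -ge0_realC.
apply: eq_eseriesr => i _; rewrite -EFinM -ReZ; congr (_%:E); congr (Re _).
exact: ipZl.
Qed.

Lemma cone_Tr A : cone S0 A ->
  exists tau, [/\ S0 tau, 0 <= fine (Tr ip A), Tr ip A = (fine (Tr ip A))%:E &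
    A = (fine (Tr ip A))%:C *: tau].
Proof. by move=> [c [tau [c0 St ->]]]; exists tau; rewrite Tr_scale_state. Qed.

Lemma cone_S0 A : cone S0 A -> Tr ip A = 1%E -> S0 A.
Proof.
by move=> /cone_Tr[tau [St _ _ AE]] tr1; move: AE; rewrite tr1 /= scale1r => ->.
Qed.

Lemma S0_cone tau : S0 tau -> cone S0 tau.
Proof. by move=> St; exists 1, tau; rewrite ler01 scale1r. Qed.

Lemma cone_comb x y A B : 0 <= x -> 0 <= y -> cone S0 A -> cone S0 B ->
  cone S0 (x%:C *: A + y%:C *: B).
Proof.
move=> x0 y0 [c [t1 [c0 S1 ->]]] [c' [t2 [c'0 S2 ->]]].
have xc := mulr_ge0 x0 c0; have yc := mulr_ge0 y0 c'0.
rewrite !scalerA -!rmorphM.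
have [s0|sn] := eqVneq (x * c + y * c') 0.
  have -> : x * c = 0 by lra.
  have -> : y * c' = 0 by lra.
  by exists 0, t1; rewrite lexx !scale0r addr0.
have s_gt0 : 0 < x * c + y * c' by rewrite lt_neqAle eq_sym sn addr_ge0.
exists (x * c + y * c'), (mix (x * c / (x * c + y * c')) t1 t2); split.
- exact: ltW.
- by apply: mix_S0 => //; rewrite divr_ge0 ?ler_pdivrMr// ?(ltW s_gt0)//=; lra.
rewrite /mix scalerDr !scalerA -!rmorphM; congr (_%:C *: _ + _%:C *: _).
  by field.
by field.
Qed.

Lemma cone_add A B : cone S0 A -> cone S0 B -> cone S0 (A + B).
Proof. by move=> CA CB; have := cone_comb ler01 ler01 CA CB; rewrite !scale1r. Qed.

Lemma cone_TrD A B : cone S0 A -> cone S0 B ->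
  fine (Tr ip (A + B)) = fine (Tr ip A) + fine (Tr ip B).
Proof.
move=> CA CB; have [lA lB] := (cone_linear CA, cone_linear CB).
have [pA pB] := (cone_positive CA, cone_positive CB).
have [_ [_ _ TA _]] := cone_Tr CA; have [_ [_ _ TB _]] := cone_Tr CB.
have [_ [_ _ TAB _]] := cone_Tr (cone_add CA CB).
apply: EFin_inj; rewrite EFinD -TA -TB -TAB.
have lAB : linear (A + B) by have := linear_comb 1 1 lA lB; rewrite !scale1r.
have pAB := positive_add pA pB.
rewrite !TrE//.
rewrite -nneseriesD => [||]; try by move=> i _; rewrite lee_fin -lecR -ge0_realC.
apply: eq_eseriesr => i _; rewrite -EFinD -ReD; congr (_%:E); congr (Re _).
exact: ipDl.
Qed.

Section Function.
Variables (f : (H -> H) -> \bar R) (a b : R -> R).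
Hypothesis f_ge0 : forall tau, S0 tau -> (0 <= f tau)%E.
Hypothesis f_aff : almost_affine S0 a b f.

Lemma homogeneous_ext_scale c tau : 0 <= c -> S0 tau ->
  homogeneous_ext ip f (c%:C *: tau) = (c%:E * f tau)%E.
Proof.
move=> c0 St; rewrite /homogeneous_ext Tr_scale_state//=.
have [->|cn] := eqVneq c 0; first by rewrite scale0r eqxx mul0e.
(* [c tau] is not the zero operator because its trace is [c]. *)
case: eqP => [ct0|_].
  have := Tr_scale_state c0 St; rewrite ct0 -(scale0r tau) -[0]/(0%:C).
  by rewrite Tr_scale_state// => -[c0']; rewrite -c0' eqxx in cn.
by rewrite scalerA -rmorphM mulVf// scale1r.
Qed.

Lemma homogeneous_ext_state tau : S0 tau -> homogeneous_ext ip f tau = f tau.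
Proof. by move=> St; rewrite -{1}[tau]scale1r homogeneous_ext_scale// mul1e. Qed.

Lemma homogeneous_ext_ge0 A : cone S0 A -> (0 <= homogeneous_ext ip f A)%E.
Proof.
move=> /cone_Tr[tau [St c0 _ ->]]; rewrite homogeneous_ext_scale//.
by rewrite mule_ge0// f_ge0.
Qed.

(** Homogeneous form of [almost_affine]: [A] and [B] are [t p] and [t (1 - p)] times states whose
    mixture with weight [p] is [(A + B) / t]; multiply by [t]. *)
Lemma almost_affine_sum A B : cone S0 A -> cone S0 B ->
  let t := fine (Tr ip (A + B)) in let p := fine (Tr ip A) / t in
  0 < t ->
  (homogeneous_ext ip f A + homogeneous_ext ip f B - (t * a p)%:E
     <= homogeneous_ext ip f (A + B)%R)%E /\
  (homogeneous_ext ip f (A + B)%R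
     <= homogeneous_ext ip f A + homogeneous_ext ip f B + (t * b p)%:E)%E.
Proof.
move=> CA CB t p t0.
have [t1 [S1 x0 _ AE]] := cone_Tr CA; have [t2 [S2 y0 _ BE]] := cone_Tr CB.
have [t3 [S3 _ TE ABE]] := cone_Tr (cone_add CA CB).
pose x := fine (Tr ip A); pose y := fine (Tr ip B).
rewrite -/x in x0 AE; rewrite -/y in y0 BE.
have tE : t = x + y by exact: cone_TrD.
have p01 : 0 <= p <= 1.
  by rewrite divr_ge0 ?(ltW t0)//= ler_pdivrMr// mul1r tE lerDl.
have xp : x = t * p by rewrite /p mulrC divfK// gt_eqF.
have yp : y = t * (1 - p) by rewrite mulrBr mulr1 -xp tE; lra.
have mixE : mix p t1 t2 = t3.
  have : t%:C *: mix p t1 t2 = t%:C *: t3.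
    by rewrite -ABE AE BE /mix scalerDr !scalerA -!rmorphM -xp -yp.
  move=> /(congr1 (fun g => (t^-1)%:C *: g)).
  by rewrite !scalerA -!rmorphM mulVf ?gt_eqF// !scale1r.
have fA : homogeneous_ext ip f A = (x%:E * f t1)%E.
  by rewrite {1}AE homogeneous_ext_scale.
have fB : homogeneous_ext ip f B = (y%:E * f t2)%E.
  by rewrite {1}BE homogeneous_ext_scale.
have fAB : homogeneous_ext ip f (A + B) = (t%:E * f t3)%E.
  by rewrite {1}ABE homogeneous_ext_scale ?ltW.
rewrite fA fB fAB xp yp.
have [lo hi] := f_aff S1 S2 p01; rewrite mixE in lo hi.
have t0e : (0 <= t%:E)%E by rewrite lee_fin ltW.
(* Nonnegativity of both terms allows distributing [t] over a sum that may be [+oo]. *)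
have p0 : (0 <= p%:E * f t1)%E by rewrite mule_ge0 ?f_ge0// lee_fin; case/andP: p01.
have q0 : (0 <= (1 - p)%:E * f t2)%E.
  by rewrite mule_ge0 ?f_ge0// lee_fin subr_ge0; case/andP: p01.
clearbody p; rewrite !EFinM -!muleA -(ge0_muleDr _ p0 q0)//; split.
  by rewrite -muleBr ?fin_num_adde_defl// lee_pmul2l.
by rewrite -muleDr ?fin_num_adde_defl// lee_pmul2l.
Qed.
End Function.
End StateCone.

(** * Decompositions of commuting states *)

Section Decomposition.
Variables (R : realType) (H : completeNormedModType R[i]).
Variable ip : {dot H for Num.conj}.
Hypothesis ip_norm : norm_from_ip ip.
Variables (d e : nat -> H).
Hypothesis od : orthonormal_system ip d.
Hypothesis cd : forall x, (forall i, ip x (d i) = 0) -> x = 0.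
Hypothesis TrE : forall B, linear B -> positive_op ip B ->
  (Tr ip B = \sum_(0 <= i <oo) (Re (ip (B (d i)) (d i)))%:E)%E.
Hypothesis oe : orthonormal_system ip e.
Hypothesis ce : forall x, (forall i, ip x (e i) = 0) -> x = 0.
Variable S0 : set (H -> H).
Hypothesis S0_states : forall rho, S0 rho -> is_state ip rho.
Hypothesis S0_convex : convex_set S0.
Variable rho : H -> H.
Hypothesis S0rho : S0 rho.
Hypothesis rho_fun : forall h : R -> R, (forall x, 0 <= x -> 0 <= h x <= x) ->
   cone S0 (fun_op ip h rho).
Hypothesis rho_parts : forall sigma, S0 sigma -> rho \o sigma = sigma \o rho ->
   sigma <> rho ->
   cone S0 (pos_part ip (rho - sigma)) /\ cone S0 (neg_part ip (rho - sigma)).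
Hypothesis drho : diagonal_in ip e rho.
Implicit Types (A B sigma : H -> H) (x y : R).
Local Notation eig := (eigval ip e).
Local Notation diag := (diagonal_in ip e).
Local Notation l := (eig rho).

Lemma eigval_eq A x i : A (e i) = x%:C *: e i -> (e i = 0 -> x = 0) -> eig A i = x.
Proof.
move=> Ax x0; have [ei|/eqP ei] := eqVneq (e i) 0; last exact: eigvalE.
by rewrite x0// /eigval ei ip0r.
Qed.

Lemma eigval_null A i : e i = 0 -> eig A i = 0.
Proof. by rewrite /eigval => ->; rewrite ip0r. Qed.

Lemma eigval_comb x y A B i :
  eig (x%:C *: A + y%:C *: B) i = x * eig A i + y * eig B i.
Proof.
rewrite /eigval -!ReZ -ReD -!ipZl -ipDl; congr (Re (ip _ _)).
Qed.

Lemma diagonal_comb x y A B : diag A -> diag B -> diag (x%:C *: A + y%:C *: B).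
Proof.
move=> dA dB; apply: (diagonal_inP oe (g := fun i => x * eig A i + y * eig B i)) => i.
transitivity (x%:C *: A (e i) + y%:C *: B (e i)); first by [].
by rewrite dA dB !scalerA -scalerDl -!rmorphM -rmorphD.
Qed.

(** The data of [SpectralCone] for the index set [nat]; the facts below verify its hypotheses. *)
Let C : set (nat -> R) :=
  [set g | exists A, [/\ cone S0 A, diag A & eig A = g]].
Let tr (g : nat -> R) : R := fine (\sum_(0 <= i <oo) (g i)%:E)%E.

Let C_eig A : cone S0 A -> diag A -> C (eig A).
Proof. by move=> CA dA; exists A. Qed.

Let rho_cone := S0_cone S0rho.

Let Tr_eig A : cone S0 A -> diag A -> (Tr ip A = \sum_(0 <= i <oo) (eig A i)%:E)%E.
Proof.
move=> CA dA; have [lA pA] := (cone_linear S0_states CA, cone_positive S0_states CA).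
by rewrite TrE// (Tr_diagonal ip_norm od cd oe ce).
Qed.

Let tr_eig A : cone S0 A -> diag A -> tr (eig A) = fine (Tr ip A).
Proof. by move=> CA dA; rewrite Tr_eig. Qed.

Let trE g : C g -> (\sum_(0 <= i <oo) (g i)%:E = (tr g)%:E)%E.
Proof.
move=> [A [CA dA <-]]; rewrite tr_eig// -Tr_eig//.
by have [? []] := cone_Tr TrE S0_states CA.
Qed.

Let C_ge0 g : C g -> forall i, 0 <= g i.
Proof. by move=> [A [CA dA <-]] i; apply: eigval_ge0; exact: cone_positive CA. Qed.

Let C_lin x y g g' : 0 <= x -> 0 <= y -> C g -> C g' -> C (fun i => x * g i + y * g' i).
Proof.
move=> x0 y0 [A [CA dA <-]] [B [CB dB <-]].
exists (x%:C *: A + y%:C *: B); split.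
- exact: cone_comb.
- exact: diagonal_comb.
- by apply/funext => i; exact: eigval_comb.
Qed.

Let fun_op_diag (h : R -> R) : (forall x, 0 <= x -> 0 <= h x <= x) ->
  diag (fun_op ip h rho) /\ eig (fun_op ip h rho) = fun i => h (l i).
Proof.
move=> hh; have lr := cone_linear S0_states rho_cone.
have pr := cone_positive S0_states rho_cone.
have hE i : fun_op ip h rho (e i) = (h (l i))%:C *: e i.
  exact: (fun_op_eigenvector ip_norm oe ce hh lr pr drho).
split; first exact: (diagonal_inP oe hE).
apply/funext => i; apply: eigval_eq => // /eigval_null ->.
by apply/eqP; rewrite eq_le; have /andP[-> ->] := hh 0 (lexx 0).
Qed.

Let C_fun (h : R -> R) : (forall x, 0 <= x -> 0 <= h x <= x) -> C (fun i => h (l i)).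
Proof.
move=> hh; have [dh <-] := fun_op_diag hh.
by apply: C_eig => //; exact: rho_fun.
Qed.

(** (b) read on eigenvalues. Both parts are positive since they lie in the cone, and [abs_op_is_abs]
    deduces from this that [abs_op] is a true absolute value. *)
Let parts A : S0 A -> diag A -> A <> rho ->
  [/\ is_abs_op ip (rho - A) (abs_op ip (rho - A)),
   forall i, (rho - A) (e i) = (l i - eig A i)%:C *: e i,
   cone S0 (pos_part ip (rho - A)) /\ cone S0 (neg_part ip (rho - A)),
   diag (pos_part ip (rho - A)) /\ diag (neg_part ip (rho - A)) &
   eig (pos_part ip (rho - A)) = (fun i => Num.max (l i - eig A i) 0) /\
   eig (neg_part ip (rho - A)) = (fun i => Num.max (eig A i - l i) 0)].
Proof.
move=> SA dA Ar; have CA := S0_cone SA.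
have [lA pA] := (cone_linear S0_states CA, cone_positive S0_states CA).
have [lr pr] := (cone_linear S0_states rho_cone, cone_positive S0_states rho_cone).
have [Cp Cn] := rho_parts SA (commute_diagonal ce lr pr drho lA pA dA) Ar.
have eigE i : (rho - A) (e i) = (l i - eig A i)%:C *: e i.
  transitivity (rho (e i) - A (e i)); first by [].
  by rewrite drho dA -scalerBl -rmorphB.
have sym u v : ip ((rho - A) u) v = ip u ((rho - A) v).
  transitivity (ip (rho u - A u) v); first by [].
  by rewrite ipBl (positive_symmetric lr pr) (positive_symmetric lA pA) -ipBr.
have absP : is_abs_op ip (rho - A) (abs_op ip (rho - A)).
  apply: (abs_op_is_abs oe ce sym eigE).
  - by move=> /eqP; rewrite subr_eq0 => /eqP /esym.
  - exact: cone_positive Cp.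
  - exact: cone_positive Cn.
have posE i := pos_part_eigenvector oe ce eigE i absP.
have negE i : neg_part ip (rho - A) (e i) = (Num.max (eig A i - l i) 0)%:C *: e i.
  by rewrite (neg_part_eigenvector oe ce eigE i absP) opprB.
split => //; split.
- exact: (diagonal_inP oe posE).
- exact: (diagonal_inP oe negE).
- apply/funext => i; apply: eigval_eq => // ei0.
  by rewrite !eigval_null// subrr maxxx.
- apply/funext => i; apply: eigval_eq => // ei0.
  by rewrite !eigval_null// subrr maxxx.
Qed.

Let C_parts g : C g -> tr g = 1 -> g <> l ->
  C (fun i => Num.max (l i - g i) 0) /\ C (fun i => Num.max (g i - l i) 0).
Proof.
move=> [A [CA dA <-]]; rewrite tr_eig// => trA gl.
have SA : S0 A.
  apply: (cone_S0 TrE S0_states CA).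
  by have [? [_ _ -> _]] := cone_Tr TrE S0_states CA; rewrite trA.
have Ar : A <> rho by move=> AE; apply: gl; rewrite AE.
have [_ _ [Cp Cn] [dp dn] [<- <-]] := parts SA dA Ar.
by split; exact: C_eig.
Qed.

Let tr_lin x y g g' : 0 <= x -> 0 <= y -> C g -> C g' ->
  tr (fun i => x * g i + y * g' i) = x * tr g + y * tr g'.
Proof.
move=> x0 y0 Cg Cg'; apply: EFin_inj.
rewrite -(trE (C_lin x0 y0 Cg Cg')) EFinD !EFinM -!trE//.
rewrite -!nneseriesZl; try by move=> i _; rewrite lee_fin C_ge0.
rewrite -nneseriesD; try by move=> i _; rewrite -EFinM lee_fin mulr_ge0// C_ge0.
by apply: eq_eseriesr => i _; rewrite EFinD !EFinM.
Qed.

Let tr_le g g' : C g -> C g' -> (forall i, g i <= g' i) -> tr g <= tr g'.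
Proof.
move=> Cg Cg' gg'; rewrite -lee_fin -!trE//.
by apply: lee_nneseries => i _; rewrite lee_fin ?C_ge0.
Qed.

Let tr_ge g i : C g -> g i <= tr g.
Proof.
move=> Cg; rewrite -lee_fin -trE//.
rewrite (nneseriesD1 (n := i))//; last by move=> k _; rewrite lee_fin C_ge0.
by rewrite leeDl// nneseries_ge0// => k _ _; rewrite lee_fin C_ge0.
Qed.

Let tr_l : tr l = 1.
Proof. by rewrite tr_eig//; have [_ _ ->] := S0_states S0rho. Qed.

Let l_finite v : 0 < v -> exists s : seq nat, forall i, v <= l i -> i \in s.
Proof.
move=> v0; have Cl := C_eig rho_cone drho.
have : cvgn (series l).
  apply: nnseries_is_cvg; first by move=> i; exact: C_ge0.
  by rewrite trE// ltry.
move=> /cvg_series_cvg_0 /cvgrPdist_lt/(_ _ v0)[N _ hN].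
exists (iota 0 N) => i vi; rewrite mem_iota add0n leq0n /= ltnNge.
apply/negP => Ni; have := hN i Ni; rewrite /= sub0r normrN ger0_norm ?C_ge0//.
by rewrite ltNge vi.
Qed.

Let wedge_fun eps x : 0 < eps -> 0 <= x -> 0 <= Num.min x eps <= x.
Proof. by move=> e0 x0; rewrite le_min x0 (ltW e0) ge_min lexx. Qed.

Let cut_fun eps x : 0 < eps -> 0 <= x -> 0 <= Num.max (x - eps) 0 <= x.
Proof. by move=> e0 x0; rewrite le_max lexx orbT ge_max x0 lerBlDr lerDl ltW. Qed.

Let eig_sum A B i : eig (A + B) i = eig A i + eig B i.
Proof. by have := eigval_comb 1 1 A B i; rewrite !scale1r !mul1r. Qed.

Let diag_sum A B : diag A -> diag B -> diag (A + B).
Proof. by move=> dA dB; have := diagonal_comb 1 1 dA dB; rewrite !scale1r. Qed.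

Let eq_cone A B : cone S0 A -> diag A -> cone S0 B -> diag B ->
  (forall i, eig A i = eig B i) -> A = B.
Proof.
move=> CA dA CB dB; have [lA lB] := (cone_linear S0_states CA, cone_linear S0_states CB).
have [pA pB] := (cone_positive S0_states CA, cone_positive S0_states CB).
exact: (eq_diagonal ce lA pA dA lB pB dB).
Qed.

Lemma wedge_cut_sum eps : 0 < eps ->
  [/\ cone S0 (wedge_op ip rho eps), cone S0 (cut_op ip rho eps),
    cut_op ip rho eps + wedge_op ip rho eps = rho &
    fine (Tr ip (wedge_op ip rho eps)) <= 1].
Proof.
move=> e0; have wf x := @wedge_fun eps x e0; have cf x := @cut_fun eps x e0.
have [dw ew] := fun_op_diag wf; have [dc ec] := fun_op_diag cf.
have Cw := rho_fun wf; have Cc := rho_fun cf; split => //.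
- apply: eq_cone => //; [exact: cone_add|exact: diag_sum|move=> i].
  rewrite eig_sum ew ec.
  by have [h|h] := leP (l i - eps) 0; have [h'|h'] := leP (l i) eps; lra.
- rewrite -tr_eig// -tr_l; apply: tr_le; [exact: C_eig|exact: C_eig|move=> i].
  by rewrite ew ge_min lexx.
Qed.

Lemma commuting_decomposition sigma eps :
  S0 sigma -> diag sigma -> sigma <> rho -> 0 < eps ->
  (2^-1%:E * trace_norm ip (rho - sigma)%R <= eps%:E)%E ->
  exists D N Th, [/\ cone S0 D, cone S0 N, cone S0 Th,
    [/\ wedge_op ip rho eps = D + Th, N + rho = D + sigma &
      sigma = cut_op ip rho eps + (N + Th)] &
    [/\ fine (Tr ip N) = fine (Tr ip D), 0 < fine (Tr ip D), fine (Tr ip D) <= eps &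
      fine (Tr ip D) <= fine (Tr ip (wedge_op ip rho eps))]].
Proof.
move=> Ss ds sr e0 trn; have Cs := S0_cone Ss.
have [absP eigE [CD CN] [dD dN] [eD eN]] := parts Ss ds sr.
set D := pos_part ip _ in CD dD eD; set N := neg_part ip _ in CN dN eN.
have NrDs : N + rho = D + sigma.
  apply: eq_cone; try by [exact: cone_add|exact: diag_sum].
  move=> i; rewrite !eig_sum eD eN.
  have [h|h] := leP (l i - eig sigma i) 0;
    by have [h'|h'] := leP (eig sigma i - l i) 0; lra.
have trs : tr (eig sigma) = 1 by rewrite tr_eig//; have [_ _ ->] := S0_states Ss.
have tr_sum A B : cone S0 A -> diag A -> cone S0 B -> diag B ->
    tr (eig (A + B)) = tr (eig A) + tr (eig B).
  move=> CA dA CB dB; have := tr_lin ler01 ler01 (C_eig CA dA) (C_eig CB dB).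
  rewrite !mul1r => <-; congr tr; apply/funext => i.
  by rewrite eig_sum !mul1r.
have trND : tr (eig N) = tr (eig D).
  have := congr1 (fun A => tr (eig A)) NrDs.
  by rewrite !tr_sum// tr_l trs => /addIr.
have absE i := is_abs_op_eigenvector oe ce eigE i absP.
(* |rho - sigma| and D + N have the same eigenvalues, and N has the same trace as D, so half the
   trace norm is [tr (eig D)]. *)
have trD : tr (eig D) <= eps.
  move: trn; rewrite /trace_norm.
  have [[linB _] posB _] := absP.
  have dB : diag (abs_op ip (rho - sigma)) by exact: (diagonal_inP oe absE).
  rewrite TrE// (Tr_diagonal ip_norm od cd oe ce)//.
  rewrite (eq_eseriesr (g := fun i => (eig (D + N) i)%:E)); last first.
    move=> i _; congr EFin; rewrite eig_sum eD eN; apply: eigval_eq => [|ei0].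
      rewrite absE; congr (_%:C *: _).
      have [h|h] := leP (l i - eig sigma i) 0; [rewrite ler0_norm//|rewrite gtr0_norm//];
        by have [h'|h'] := leP (eig sigma i - l i) 0; lra.
    by rewrite !eigval_null// !subrr !maxxx addr0.
  rewrite trE; last by apply: C_eig; [exact: cone_add|exact: diag_sum].
  rewrite tr_sum// trND -EFinM lee_fin; lra.
have trD0 : 0 < tr (eig D).
  rewrite lt_neqAle; apply/andP; split; last first.
    apply: le_trans (tr_ge 0 (C_eig CD dD)).
    exact: (C_ge0 (C_eig CD dD)).
  (* If the trace of D vanished, so would that of N, hence all eigenvalues of both parts, and sigma
     would be rho. *)
  apply/eqP => /esym D0; apply: sr; apply: eq_cone => // i.
  have := tr_ge i (C_eig CD dD); have := tr_ge i (C_eig CN dN).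
  rewrite trND D0 eD eN !ge_max => /andP[h1 _] /andP[h2 _].
  by apply/eqP; rewrite eq_le; lra.
have le_eps i : l i - eig sigma i <= eps.
  apply: le_trans trD; apply: le_trans (tr_ge i (C_eig CD dD)).
  by rewrite eD le_max lexx.
have := min_sub_pos_part C_ge0 C_lin C_fun C_parts tr_lin _ tr_le tr_l l_finite
  e0 (C_eig Cs ds) trs le_eps.
move=> [|Th [CTh dTh eTh]].
  by move=> g i Cg gi; apply: lt_le_trans gi _; exact: tr_ge.
have [Cw Cc cw _] := wedge_cut_sum e0.
have [dw ew] := fun_op_diag (fun x => @wedge_fun eps x e0).
have [dc ec] := fun_op_diag (fun x => @cut_fun eps x e0).
have wE : wedge_op ip rho eps = D + Th.
  apply: eq_cone => //; [exact: cone_add|exact: diag_sum|move=> i].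
  by rewrite eig_sum ew eD eTh addrC subrK.
exists D, N, Th; split => //; split => //.
(* Substitute rho = cut + D + Th into D + sigma = N + rho and cancel D. *)
- apply: (addIr D); rewrite [LHS]addrC -NrDs -[in LHS]cw wE addrCA -!addrA.
  by rewrite [Th + D]addrC.
- by rewrite -!tr_eig.
- by rewrite -tr_eig.
- by rewrite -tr_eig.
- rewrite -!tr_eig//; apply: tr_le; [exact: C_eig|exact: C_eig|move=> i].
  by rewrite wE eig_sum lerDl; apply: eigval_ge0; exact: cone_positive CTh.
Qed.
End Decomposition.

(** * The two lower bounds for f(sigma) *)

Section LowerBounds.
Variables (R : realType) (H : completeNormedModType R[i]).
Variable ip : {dot H for Num.conj}.
Hypotheses (ip_norm : norm_from_ip ip) (H_sep : separable_space H).
Variable S0 : set (H -> H).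
Hypothesis S0_states : forall rho, S0 rho -> is_state ip rho.
Hypothesis S0_convex : convex_set S0.
Variable rho : H -> H.
Hypothesis S0rho : S0 rho.
Hypothesis rho_fun : forall h : R -> R, (forall x, 0 <= x -> 0 <= h x <= x) ->
  cone S0 (fun_op ip h rho).
Hypothesis rho_parts : forall sigma, S0 sigma -> rho \o sigma = sigma \o rho ->
  sigma <> rho ->
  cone S0 (pos_part ip (rho - sigma)) /\ cone S0 (neg_part ip (rho - sigma)).

Lemma exists_trace_system : exists d : nat -> H, [/\ orthonormal_system ip d,
  forall x, (forall i, ip x (d i) = 0) -> x = 0 &
  forall B, linear B -> positive_op ip B ->
    (Tr ip B = \sum_(0 <= i <oo) (complex.Re (ip (B (d i)) (d i)))%:E)%E].
Proof.
have [[lr _] pr trr] := S0_states S0rho.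
have trr0 : Tr ip rho <> 0%E by rewrite trr => -[/eqP]; rewrite oner_eq0.
exact: (Tr_system ip_norm H_sep trr0 lr pr).
Qed.

Lemma joint_eigensystem sigma : S0 sigma -> rho \o sigma = sigma \o rho ->
  exists e : nat -> H, [/\ orthonormal_system ip e,
    forall x, (forall i, ip x (e i) = 0) -> x = 0,
    diagonal_in ip e rho & diagonal_in ip e sigma].
Proof.
have [d [od cd TrE]] := exists_trace_system.
move=> Ss comm; have [bndr pr trr] := S0_states S0rho.
have [bnds ps trs] := S0_states Ss.
have [lr _] := bndr; have [ls _] := bnds.
have trr' : (\sum_(0 <= i <oo) (complex.Re (ip (rho (d i)) (d i)))%:E < +oo)%E.
  by rewrite -TrE// trr ltry.
have trs' : (\sum_(0 <= i <oo) (complex.Re (ip (sigma (d i)) (d i)))%:E < +oo)%E.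
  by rewrite -TrE// trs ltry.
have [E [bE eE]] := joint_eigenbasis ip_norm od cd bndr pr trr' bnds ps trs' comm.
have [e [oe ce eE' _]] := orthonormal_basis_system ip_norm H_sep bE.
exists e; split => //.
  have /choice[g gE] : forall i, exists r : R, rho (e i) = r%:C *: e i.
    move=> i; have [->|/eE[]//] := eE' i.
    by exists 0; rewrite scaler0 (lin_op0 lr).
  exact: (diagonal_inP oe gE).
have /choice[g gE] : forall i, exists r : R, sigma (e i) = r%:C *: e i.
  move=> i; have [->|/eE[]//] := eE' i.
  by exists 0; rewrite scaler0 (lin_op0 ls).
exact: (diagonal_inP oe gE).
Qed.

Lemma cut_wedge_decomposition eps : 0 < eps ->
  [/\ cone S0 (wedge_op ip rho eps), cone S0 (cut_op ip rho eps),
    cut_op ip rho eps + wedge_op ip rho eps = rho &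
    fine (Tr ip (wedge_op ip rho eps)) <= 1].
Proof.
have [d [od cd TrE]] := exists_trace_system.
(* Since rho commutes with itself, joint diagonalization also gives an eigenbasis of rho alone. *)
have [e [oe ce dr _]] := joint_eigensystem S0rho erefl.
exact: (wedge_cut_sum ip_norm od cd TrE oe ce).
Qed.

Lemma excess_decomposition sigma eps : S0 sigma -> rho \o sigma = sigma \o rho ->
  sigma <> rho -> 0 < eps ->
  (2^-1%:E * trace_norm ip (rho - sigma)%R <= eps%:E)%E ->
  exists D N Th, [/\ cone S0 D, cone S0 N, cone S0 Th,
    [/\ wedge_op ip rho eps = D + Th, N + rho = D + sigma &
      sigma = cut_op ip rho eps + (N + Th)] &
    [/\ fine (Tr ip N) = fine (Tr ip D), 0 < fine (Tr ip D), fine (Tr ip D) <= eps &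
      fine (Tr ip D) <= fine (Tr ip (wedge_op ip rho eps))]].
Proof.
move=> Ss comm; have [d [od cd TrE]] := exists_trace_system.
have [e [oe ce dr ds]] := joint_eigensystem Ss comm.
exact: (commuting_decomposition ip_norm od cd TrE oe ce).
Qed.

Variables (f : (H -> H) -> \bar R) (a b : R -> R).
Hypotheses (a_mod : modulus a) (b_mod : modulus b).
Hypothesis f_ge0 : forall tau, S0 tau -> (0 <= f tau)%E.
Hypothesis f_aff : almost_affine S0 a b f.
Variables (sigma : H -> H) (eps : R).
Hypotheses (S0sigma : S0 sigma) (eps_gt0 : 0 < eps) (eps_le1 : eps <= 1).
Hypothesis commute : rho \o sigma = sigma \o rho.
Hypothesis close : (2^-1%:E * trace_norm ip (rho - sigma)%R <= eps%:E)%E.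
Local Notation h := (homogeneous_ext ip f).

(** Write sigma as the cut plus some [X] in the cone. The sum has trace 1, so the lower inequality
    has error [a(r)] with [r] the trace of the cut, equal to [a(1 - r)] by symmetry; the term f~(X)
    >= 0 is dropped. *)
Lemma cut_le : (h (cut_op ip rho eps)
  <= f sigma + (a (1 - fine (Tr ip (cut_op ip rho eps))))%:E)%E.
Proof.
have [d [od cd TrE]] := exists_trace_system.
have [Cw Cc cw _] := cut_wedge_decomposition eps_gt0.
have [X CX sE] : exists2 X, cone S0 X & sigma = cut_op ip rho eps + X.
  have [->|sr] := pselect (sigma = rho); first by exists (wedge_op ip rho eps).
  have [D [N [Th [_ CN CTh [_ _ ->] _]]]] :=
    excess_decomposition S0sigma commute sr eps_gt0 close.
  by exists (N + Th) => //; exact: cone_add.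
have trs : fine (Tr ip sigma) = 1 by have [_ _ ->] := S0_states S0sigma.
have := almost_affine_sum TrE S0_states S0_convex f_ge0 f_aff Cc CX.
rewrite /= -sE trs divr1 mul1r => /(_ ltr01)[+ _].
rewrite (homogeneous_ext_state TrE S0_states _ S0sigma) EFinN leeBlDr// => le_sum.
have c0 := @cone_Tr _ _ _ _ TrE _ S0_states _ Cc.
have x0 := @cone_Tr _ _ _ _ TrE _ S0_states _ CX.
have trE := cone_TrD TrE S0_states S0_convex Cc CX.
rewrite -sE trs in trE.
rewrite -modulus_sym//; last first.
  by have [? [_ ? _ _]] := c0; have [? [_ ? _ _]] := x0; lra.
apply: le_trans le_sum; rewrite leeDl//.
exact: (homogeneous_ext_ge0 TrE S0_states).
Qed.

(** Combines the lower inequality for N + rho, the upper one for D + sigma, which is the same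
    operator, and the lower one for D + Th; f~(N) and f~(Th) are dropped as nonnegative. *)
Lemma state_sub_wedge_le : (f rho < +oo)%E ->
  (f rho - h (wedge_op ip rho eps) - (Dfun a b eps)%:E - (flat_ext a eps)%:E
    <= f sigma)%E.
Proof.
move=> fr_fin; have [d [od cd TrE]] := exists_trace_system.
have [Cw Cc cw w1] := cut_wedge_decomposition eps_gt0.
have h_ge0 A : cone S0 A -> (0 <= h A)%E by exact: (homogeneous_ext_ge0 TrE S0_states).
have D0 : 0 <= Dfun a b eps by apply: Dfun_ge0 => //; exact: ltW.
have F0 : 0 <= flat_ext a eps by apply: flat_ext_ge0 => //; exact: ltW.
have fr0 := f_ge0 S0rho; have fs0 := f_ge0 S0sigma; have hw0 := h_ge0 _ Cw.
(* If f(sigma) is infinite the bound is trivial, and if f~(rho /\ eps) is, its left side is [-oo];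
   the remaining case is real arithmetic. *)
have [fsy|fs_fin] := eqVneq (f sigma) +oo%E; first by rewrite fsy leey.
have [hwy|hw_fin] := eqVneq (h (wedge_op ip rho eps)) +oo%E.
  by rewrite hwy; case: (f rho) fr_fin => [r||] //= _; rewrite leNye.
have [X frE] : exists X, f rho = X%:E by case: (f rho) fr0 fr_fin => // X; exists X.
have [S fsE] : exists S, f sigma = S%:E by case: (f sigma) fs0 fs_fin => // S; exists S.
have [W hwE] : exists W, h (wedge_op ip rho eps) = W%:E.
  by case: (h _) hw0 hw_fin => // W; exists W.
rewrite frE fsE hwE -!EFinB lee_fin.
rewrite hwE lee_fin in hw0.
have [sr|sr] := pselect (sigma = rho).
  have : S = X by apply: EFin_inj; rewrite -fsE -frE sr.
  lra.
have [D [N [Th [CD CN CTh [wE NrDs _] [trND trD0 trDe trDw]]]]] :=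
  excess_decomposition S0sigma commute sr eps_gt0 close.
have Cr := S0_cone S0rho; have Cs := S0_cone S0sigma.
have trr : fine (Tr ip rho) = 1 by have [_ _ ->] := S0_states S0rho.
have sum := almost_affine_sum TrE S0_states S0_convex f_ge0 f_aff.
have TrD := cone_TrD TrE S0_states S0_convex.
set dl := fine (Tr ip D) in trND trD0 trDe trDw *.
set s := fine (Tr ip (wedge_op ip rho eps)) in w1 trDw *.
have trNr : fine (Tr ip (N + rho)) = 1 + dl by rewrite TrD// trr trND addrC.
have t0 : 0 < 1 + dl by lra.
have := sum _ _ CN Cr; rewrite /= trNr trND EFinN.
rewrite (homogeneous_ext_state TrE S0_states _ S0rho) => /(_ t0)[lo _].
have := sum _ _ CD Cs; rewrite /= -NrDs trNr.
rewrite (homogeneous_ext_state TrE S0_states _ S0sigma) => /(_ t0)[_ hi].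
have s0 : 0 < s by exact: lt_le_trans trDw.
have := sum _ _ CD CTh; rewrite /= EFinN -wE -/s -/dl => /(_ s0)[wlo _].
have hD0 := h_ge0 _ CD.
(* Besides bounding f~(D), this shows that it is finite, so that it can be eliminated between the
   inequalities. *)
have hD_le : (h D <= W%:E + (s * a (dl / s))%:E)%E.
  by rewrite -hwE -leeBlDr//; apply: le_trans wlo; rewrite leeB// leeDl// h_ge0.
have [V hDE] : exists V, h D = V%:E.
  by move: hD0 hD_le; case: (h D) => // V _ _; exists V.
have : (f rho - ((1 + dl) * a (dl / (1 + dl)))%:E
    <= h D + f sigma + ((1 + dl) * b (dl / (1 + dl)))%:E)%E.
  by apply: le_trans hi; apply: le_trans lo; rewrite leeB// leeDr// h_ge0.
move: hD_le; rewrite frE fsE hDE -!EFinD !lee_fin.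
have := Dfun_ge a_mod b_mod (ltW trD0) trDe eps_le1.
have := modulus_perspective_le_flat_ext a_mod (ltW trD0) trDw s0 w1 trDe.
rewrite mulrDr; lra.
Qed.
End LowerBounds.

Theorem lemma2 (R : realType) (H : completeNormedModType R[i])
    (ip : {dot H for Num.conj})
    (ip_norm : norm_from_ip ip)
    (H_sep : separable_space H)
    (S0 : set (H -> H))
    (S0_states : forall rho, S0 rho -> is_state ip rho)
    (S0_convex : convex_set S0)
    (a b : R -> R) (a_mod : modulus a) (b_mod : modulus b)
    (f : (H -> H) -> \bar R)
    (f_ge0 : forall rho, S0 rho -> (0 <= f rho)%E)
    (f_aff : almost_affine S0 a b f)
    (rho : H -> H) (S0rho : S0 rho)
    (rho_fun : forall h : R -> R, (forall x, 0 <= x -> 0 <= h x <= x) ->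
       cone S0 (fun_op ip h rho))
    (rho_parts : forall sigma, S0 sigma -> rho \o sigma = sigma \o rho ->
       sigma <> rho ->
       cone S0 (pos_part ip (rho - sigma)) /\
       cone S0 (neg_part ip (rho - sigma))) :
  ((f rho < +oo)%E ->
   forall (sigma : H -> H) (eps : R), S0 sigma -> 0 < eps ->
     rho \o sigma = sigma \o rho ->
     (2^-1%:E * trace_norm ip (rho - sigma)%R <= eps%:E)%E -> eps <= 1 ->
     (f rho - homogeneous_ext ip f (wedge_op ip rho eps)
        - (Dfun a b eps)%:E - (flat_ext a eps)%:E <= f sigma)%E)
  /\
  ((f rho < +oo)%E \/
   (forall eps : R, 0 < eps <= 1 ->
      (homogeneous_ext ip f (cut_op ip rho eps) < +oo)%E) ->
   forall (sigma : H -> H) (eps : R), S0 sigma -> 0 < eps ->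
     rho \o sigma = sigma \o rho ->
     (2^-1%:E * trace_norm ip (rho - sigma)%R <= eps%:E)%E -> eps <= 1 ->
     (homogeneous_ext ip f (cut_op ip rho eps)
        - (Dfun a b eps)%:E - (flat_ext a eps)%:E
        - (a (1 - fine (Tr ip (cut_op ip rho eps))))%:E <= f sigma)%E).
Proof.
split=> [fr_fin|_] sigma eps Ss e0 comm close e1.
  exact: (state_sub_wedge_le ip_norm H_sep S0_states S0_convex S0rho rho_fun rho_parts).
rewrite !leeBlDr//.
apply: le_trans (cut_le ip_norm H_sep S0_states S0_convex S0rho rho_fun rho_parts
  a_mod f_ge0 f_aff Ss e0 comm close) _.
(* The two other terms subtracted in B) are nonnegative, so B) is weaker than [cut_le]. *)
have D0 : 0 <= Dfun a b eps by apply: Dfun_ge0 => //; exact: ltW.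
have F0 : 0 <= flat_ext a eps by apply: flat_ext_ge0 => //; exact: ltW.
by rewrite -addeA leeDl// -EFinD lee_fin addr_ge0.
Qed.
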